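(* Let $R$ be a commutative ring, let $S$ be a finitely presented commutative $R$-algebra, and let $F$ be a finitely presented $S$-module. Assume that $F$ is a flat $R$-module. Then $F$ is a finitely very flat $R$-module.
   Context: All rings are commutative with unit. A commutative $R$-algebra is finitely presented if it is isomorphic to $R[x_1,\dots,x_m]/I$ with $I$ a finitely generated ideal; a module is finitely presented if it is the cokernel of a map of finitely generated free modules. For $r\in R$, $R[r^{-1}]$ is the localization at the powers of $r$. For a finite set $\mathbf r=\{r_1,\dots,r_m\}\subset R$, an $R$-module $C$ is $\mathbf r$-contraadjusted if $\mathrm{Ext}^1_R(R[r_j^{-1}],C)=0$ for all $1\le j\le m$, and an $R$-module $F$ is $\mathbf r$-very flat if $\mathrm{Ext}^1_R(F,C)=0$ for every $\mathbf r$-contraadjusted $R$-module $C$. An $R$-module $F$ is finitely very flat if there exists a finite subset $\mathbf r\subset R$ such that $F$ is $\mathbf r$-very flat. *)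

(* Defs.v *)
From HB Require Import structures.
From mathcomp Require Import all_boot all_order all_algebra.

Set Implicit Arguments.
Unset Strict Implicit.
Unset Printing Implicit Defensive.

Import GRing.Theory.
Local Open Scope ring_scope.

Definition resmod (R S : pzRingType) (phi : {rmorphism R -> S})
  (F : lmodType S) : Type := F.

Section Restriction.
Variables (R S : pzRingType) (phi : {rmorphism R -> S}) (F : lmodType S).

Local Notation resmod := (resmod phi F).
HB.instance Definition _ := GRing.Zmodule.on resmod.

Definition resmod_scale (a : R) (x : resmod) : resmod := (phi a *: (x : F) : F).

Lemma resmod_scalerA a b (v : resmod) :
  resmod_scale a (resmod_scale b v) = resmod_scale (a * b) v.
Proof. by rewrite /resmod_scale scalerA rmorphM. Qed.

Lemma resmod_scale1r : left_id 1 resmod_scale.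
Proof. by move=> v; rewrite /resmod_scale rmorph1 scale1r. Qed.

Lemma resmod_scalerDr : right_distributive resmod_scale +%R.
Proof. by move=> a u v; rewrite /resmod_scale scalerDr. Qed.

Lemma resmod_scalerDl (v : resmod) :
  {morph resmod_scale^~ v : a b / a + b}.
Proof. by move=> a b; rewrite /resmod_scale rmorphD scalerDl. Qed.

HB.instance Definition _ := GRing.Zmodule_isLmodule.Build R resmod
  resmod_scalerA resmod_scale1r resmod_scalerDr resmod_scalerDl.
End Restriction.

Section ModuleNotions.
Variable R : comPzRingType.

(* Ext^1_R(M, C) = 0, via the Yoneda description of Ext^1: every short *)
(* exact sequence 0 -> C -i-> E -p-> M -> 0 of R-modules splits.       *)
Definition Ext1_vanishes (M C : lmodType R) : Prop :=
  forall (E : lmodType R) (i : {linear C -> E}) (p : {linear E -> M}),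
    injective i ->
    (forall m : M, exists e : E, p e = m) ->
    (forall e : E, p e = 0 <-> exists c : C, e = i c) ->
    exists s : {linear M -> E}, forall m : M, p (s m) = m.

(* (L, u) is (a copy of) the R-module R[r^-1], with u the image of 1:  *)
(* multiplication by r is bijective on L, every element is a/r^n, and  *)
(* a/1 = 0 iff a is killed by a power of r.  This determines L up to   *)
(* isomorphism with the localization R[r^-1] (as R-modules).            *)
Definition is_localization_at (r : R) (L : lmodType R) (u : L) : Prop :=
  [/\ injective (fun x : L => r *: x),
      (forall x : L, exists y : L, r *: y = x),
      (forall x : L, exists (n : nat) (a : R), r ^+ n *: x = a *: u) &
      (forall a : R, a *: u = 0 <-> exists n : nat, r ^+ n * a = 0)].

Definition contraadjusted (rs : seq R) (C : lmodType R) : Prop :=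
  forall r : R, r \in rs ->
  forall (L : lmodType R) (u : L), is_localization_at r u -> Ext1_vanishes L C.

Definition very_flat (rs : seq R) (F : lmodType R) : Prop :=
  forall C : lmodType R, contraadjusted rs C -> Ext1_vanishes F C.

Definition finitely_very_flat (F : lmodType R) : Prop :=
  exists rs : seq R, very_flat rs F.

Definition bilinear_map (N M Q : lmodType R) (b : N -> M -> Q) : Prop :=
  (forall (m : M) (a : R) (x y : N), b (a *: x + y) m = a *: b x m + b y m) /\
  (forall (n : N) (a : R) (x y : M), b n (a *: x + y) = a *: b n x + b n y).

(* The element  sum_k n_k (x) m_k  of N (x)_R M vanishes; by the        *)
(* universal property of the tensor product this means that every      *)
(* R-bilinear map out of N x M kills it.                                *)
Definition tensor_zero (N M : lmodType R) (s : seq (N * M)) : Prop :=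
  forall (Q : lmodType R) (b : N -> M -> Q), bilinear_map b ->
    \sum_(x <- s) b x.1 x.2 = 0.

Definition flat (M : lmodType R) : Prop :=
  forall (N N' : lmodType R) (f : {linear N -> N'}), injective f ->
  forall s : seq (N * M),
    tensor_zero [seq (f x.1, x.2) | x <- s] -> tensor_zero s.

End ModuleNotions.

Definition fin_pres_module (S : pzRingType) (F : lmodType S) : Prop :=
  exists (n m : nat) (f : 'I_n -> F) (A : 'M[S]_(m, n)),
    (forall x : F, exists v : 'rV[S]_n, \sum_(i < n) v 0 i *: f i = x) /\
    (forall v : 'rV[S]_n,
        \sum_(i < n) v 0 i *: f i = 0 <-> exists u : 'rV[S]_m, v = u *m A).

(* Polynomial ring R[x_0, ..., x_(m-1)] as iterated univariate polys:  *)
(* mpoly R (m+1) = (mpoly R m)[x_m].                                    *)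
Fixpoint mpoly (R : comNzRingType) (m : nat) : comNzRingType :=
  match m with
  | 0 => R
  | m'.+1 => ({poly (mpoly R m')} : comNzRingType)
  end.

Fixpoint meval (R : comNzRingType) (S : comPzRingType) (phi : R -> S)
    (s : nat -> S) (m : nat) : mpoly R m -> S :=
  match m return mpoly R m -> S with
  | 0 => fun c => phi c
  | m'.+1 => fun p : {poly (mpoly R m')} =>
      \sum_(i < size p) meval phi s (p`_i) * s m' ^+ i
  end.

Definition fin_pres_algebra (R : comNzRingType) (S : comPzRingType)
    (phi : {rmorphism R -> S}) : Prop :=
  exists (m : nat) (s : nat -> S) (k : nat) (g : 'I_k -> mpoly R m),
    (forall x : S, exists p : mpoly R m, meval phi s p = x) /\
    (forall p : mpoly R m,
        meval phi s p = 0 <->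
        exists q : 'I_k -> mpoly R m, p = \sum_(j < k) q j * g j).

(* Main.v *)
Require Import Defs.
From HB Require Import structures.
From mathcomp Require Import all_boot all_order all_algebra.
From mathcomp Require Import boolp.
From mathcomp.classical Require Import functions.
From mathcomp.multinomials Require Import mpoly.

(* Write [F = P / K] with [P] a free [R]-module on monomials.  All the data
   defining [K] come from a Noetherian ring [A] mapping to [R], and by Noetherian
   induction on the ideals [I] of [A] one finds finitely many [r] such that every
   homomorphism from [K] to a contraadjusted module [C] killed by [I] extends to
   [P], i.e. [Ext^1(F, C) = 0].
   In the inductive step, an associated prime of [A / I] and a Groebner basis
   modulo this prime give [r] outside [I] such that, modulo [I], [F[1/r]] is free
   on explicit monomials of [F].  The vanishing for modules killed by [I + (r)]
   gives [Ext^1(F, C / r C) = 0] and kills the obstruction in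
   [Ext^2(F, ker (r : C -> C))], so [Ext^1(F, C)] is [r]-divisible.  An
   [r]-divisible sequence of classes starting at a given one is a class in
   [Ext^1(F[1/r], C) = 0], so the given class vanishes.  Flatness of [F] enters
   only through [L P `&` K = L K] for ideals [L] of [R]. *)

(** The obstacle is that [telescopes r], which expresses Ext^1(R[1/r], C) = 0, passes to quotients
    of [C] but not to submodules. So C / r C is within reach of the induction hypothesis, while ker
    (r : C -> C) is not. The obstruction living on that kernel is therefore represented by an
    extension of [K], cut down until it is killed by I + (r) and mapped into a reduced power, which
    telescopes for every ring element; purity keeps the kernel embedded along the way.

    The quotient that the lifted relations present over [A] need not be flat over [A]. Hence only
    leading terms are computed there, and all homological steps take place over [R].

    The element inverted in the inductive step is a product r s. The factor r makes (I : r) prime; s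
    is a product of leading coefficients modulo that prime, finitely many by Dickson's lemma, so s
    stays outside (I : r) and I + (r s) is strictly larger than I. Multiplying relations by r turns
    congruences modulo (I : r) into congruences modulo I. *)

Set Implicit Arguments.
Unset Strict Implicit.
Unset Printing Implicit Defensive.

Import GRing.Theory Num.Theory Order.TTheory.
Local Open Scope ring_scope.

(** * Submodules and subquotients *)

Definition submodule (R : pzRingType) (M : lmodType R) (A : M -> Prop) : Prop :=
  A 0 /\ forall a x y, A x -> A y -> A (a *: x + y).

Definition linear_on (R : pzRingType) (M N : lmodType R) (A : M -> Prop)
    (u : M -> N) : Prop :=
  forall a x y, A x -> A y -> u (a *: x + y) = a *: u x + u y.

Section Submodule.
Variables (R : pzRingType) (M : lmodType R) (A : M -> Prop).
Hypothesis hA : submodule A.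

Lemma submodule0 : A 0. Proof. by case: hA. Qed.

Lemma submoduleD x y : A x -> A y -> A (x + y).
Proof. by move=> hx hy; have := hA.2 1 _ _ hx hy; rewrite scale1r. Qed.

Lemma submoduleZ a x : A x -> A (a *: x).
Proof. by move=> hx; have := hA.2 a _ _ hx submodule0; rewrite addr0. Qed.

Lemma submoduleN x : A x -> A (- x).
Proof. by move=> hx; rewrite -scaleN1r; apply: submoduleZ. Qed.

Lemma submoduleB x y : A x -> A y -> A (x - y).
Proof. by move=> hx hy; apply: submoduleD => //; apply: submoduleN. Qed.

Lemma submodule_sum (I : Type) (s : seq I) (P : pred I) (F : I -> M) :
  (forall i, P i -> A (F i)) -> A (\sum_(i <- s | P i) F i).
Proof.
by move=> h; apply: (big_ind A) => //; [exact: submodule0 | exact: submoduleD].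
Qed.

Variables (N : lmodType R) (u : M -> N).
Hypothesis hu : linear_on A u.

Lemma linear_on0 : u 0 = 0.
Proof.
have := hu (-1) submodule0 submodule0.
by rewrite scaler0 addr0 scaleN1r addNr.
Qed.

Lemma linear_onD x y : A x -> A y -> u (x + y) = u x + u y.
Proof. by move=> hx hy; have := hu 1 hx hy; rewrite !scale1r. Qed.

Lemma linear_onZ a x : A x -> u (a *: x) = a *: u x.
Proof.
by move=> hx; have := hu a hx submodule0; rewrite !addr0 linear_on0 addr0.
Qed.

Lemma linear_onN x : A x -> u (- x) = - u x.
Proof. by move=> hx; rewrite -scaleN1r linear_onZ // scaleN1r. Qed.

Lemma linear_onB x y : A x -> A y -> u (x - y) = u x - u y.
Proof.
by move=> hx hy; rewrite linear_onD ?linear_onN //; apply: submoduleN.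
Qed.
End Submodule.

Lemma submoduleT (R : pzRingType) (M : lmodType R) :
  submodule (fun _ : M => True).
Proof. by []. Qed.

Lemma submodule_eq0 (R : pzRingType) (M : lmodType R) :
  submodule (fun x : M => x = 0).
Proof. by split=> // a x y -> ->; rewrite scaler0 addr0. Qed.

Lemma linear_exists (R : pzRingType) (M N : lmodType R) (f : M -> N) :
  linear f -> exists g : {linear M -> N}, g =1 f.
Proof.
move=> hf; pose m := GRing.isLinear.Build R M N *:%R f hf.
pose g : {linear M -> N} := HB.pack f m.
by exists g.
Qed.

Section Subquotient.
Variables (R : pzRingType) (M : lmodType R) (A Z : M -> Prop).
Hypotheses (hA : submodule A) (hZ : submodule Z).

(** Canonical representatives: [choose] returns the same element for equal cosets, so the quotient
    can be realised as a subtype of [M]. *)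
Let coset x : pred M := fun y => `[< A y /\ Z (x - y) >].
Let rep (x : M) : M := choose (coset x) x.

Let cosetxx x : A x -> coset x x.
Proof. by move=> hx; apply/asboolP; split; rewrite ?subrr; case: hZ. Qed.

Let repP x : A x -> A (rep x) /\ Z (x - rep x).
Proof.
by move=> hx; have /asboolP := @chooseP _ (coset x) x (cosetxx hx).
Qed.

Let rep_eq x y : A x -> A y -> Z (x - y) -> rep x = rep y.
Proof.
move=> hx hy hxy.
rewrite /rep (@choose_id _ (coset x) x y); last 2 first.
- exact: cosetxx.
- by apply/asboolP.
apply: eq_choose => z; apply/asboolP/asboolP => -[Az hz]; split=> //.
  have -> : y - z = (x - z) - (x - y) by rewrite opprB [RHS]addrC addrA subrK.
  exact: submoduleB.
have -> : x - z = (x - y) + (y - z) by rewrite addrA subrK.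
exact: submoduleD.
Qed.

Let T : choiceType := {x : M | `[< A x /\ rep x = x >]}.

Let mkP x : A x -> `[< A (rep x) /\ rep (rep x) = rep x >].
Proof.
move=> hx; have [h1 h2] := repP hx; apply/asboolP; split=> //.
apply/esym/rep_eq => //.
Qed.

Let pi (x : M) : T :=
  match pselect (A x) with
  | left hx => exist _ (rep x) (mkP hx)
  | right _ => exist _ (rep 0) (mkP (submodule0 hA))
  end.

Let val_pi x : A x -> val (pi x) = rep x.
Proof. by move=> hx; rewrite /pi; case: pselect. Qed.

Let valA (d : T) : A (val d).
Proof. by case: d => x /= /asboolP []. Qed.

Let pi_val (d : T) : pi (val d) = d.
Proof.
by apply: val_inj; rewrite val_pi; [case: d => x /= /asboolP [] | exact: valA].
Qed.

Let pi_eq x y : A x -> A y -> Z (x - y) -> pi x = pi y.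
Proof. by move=> hx hy hxy; apply: val_inj; rewrite !val_pi //; apply: rep_eq. Qed.

Let Z_val_pi x : A x -> Z (x - val (pi x)).
Proof. by move=> hx; rewrite val_pi //; case: (repP hx). Qed.

Let add (c d : T) : T := pi (val c + val d).
Let opp (d : T) : T := pi (- val d).
Let scale (a : R) (d : T) : T := pi (a *: val d).

Let ADD x y : A x -> A y -> A (x + y) := @submoduleD _ _ _ hA x y.
Let AZ a x : A x -> A (a *: x) := @submoduleZ _ _ _ hA a x.
Let AN x : A x -> A (- x) := @submoduleN _ _ _ hA x.

Let pi_add x y : A x -> A y -> add (pi x) (pi y) = pi (x + y).
Proof.
move=> hx hy; have h1 := valA (pi x); have h2 := valA (pi y).
rewrite /add; apply: esym; apply: (pi_eq (ADD hx hy) (ADD h1 h2)).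
rewrite opprD addrACA.
exact: (submoduleD hZ (Z_val_pi hx) (Z_val_pi hy)).
Qed.

Let pi_opp x : A x -> opp (pi x) = pi (- x).
Proof.
move=> hx; have h1 := valA (pi x).
rewrite /opp; apply: esym; apply: (pi_eq (AN hx) (AN h1)).
by rewrite -opprD; exact: (submoduleN hZ (Z_val_pi hx)).
Qed.

Let pi_scale a x : A x -> scale a (pi x) = pi (a *: x).
Proof.
move=> hx; have h1 := valA (pi x).
rewrite /scale; apply: esym; apply: (pi_eq (AZ a hx) (AZ a h1)).
by rewrite -scalerBr; exact: (submoduleZ hZ a (Z_val_pi hx)).
Qed.

Let addA : associative add.
Proof.
move=> a b c; rewrite -[a]pi_val -[b]pi_val -[c]pi_val.
by rewrite !pi_add ?addrA //; apply: ADD.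
Qed.

Let addC : commutative add.
Proof. by move=> a b; rewrite /add addrC. Qed.

Let add0 : left_id (pi 0) add.
Proof.
by move=> a; rewrite -[a]pi_val pi_add ?add0r //; exact: submodule0.
Qed.

Let addN : left_inverse (pi 0) opp add.
Proof.
by move=> a; rewrite -[a]pi_val pi_opp // pi_add ?addNr //; apply: AN.
Qed.

Let zmodMixin := GRing.isZmodule.Build T addA addC add0 addN.
Let Tz : zmodType := HB.pack (Choice.sort T) zmodMixin (Choice.class T).

Let scaleA a b d : scale a (scale b d) = scale (a * b) d.
Proof. by rewrite -[d]pi_val !pi_scale ?scalerA //; apply: AZ. Qed.

Let scale1 : left_id 1 scale.
Proof. by move=> d; rewrite -[d]pi_val pi_scale ?scale1r. Qed.

Let scaleDr : right_distributive scale (+%R : Tz -> Tz -> Tz).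
Proof.
move=> a c d; rewrite -[c]pi_val -[d]pi_val.
have E x y : x + y = add x y :> Tz by [].
rewrite !E pi_add // !pi_scale ?pi_add ?scalerDr //; try exact: AZ.
exact: ADD.
Qed.

Let scaleDl d : {morph (scale^~ d : R -> Tz) : a b / a + b}.
Proof.
move=> a b /=; rewrite -[d]pi_val.
have E x y : x + y = add x y :> Tz by [].
by rewrite E !pi_scale // pi_add ?scalerDl //; apply: AZ.
Qed.

Let lmodMixin :=
  GRing.Zmodule_isLmodule.Build R Tz scaleA scale1 scaleDr scaleDl.
Let Tl : lmodType R :=
  HB.pack (GRing.Zmodule.sort Tz) lmodMixin (GRing.Zmodule.class Tz).

(** [Z] need not lie in [A], so the module is [A] modulo its intersection with [Z]; the map [p] is
    total but meaningful on [A] only. With [Z] zero this turns a submodule or an ideal into a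
    module. *)
Lemma subquotient :
  exists (D : lmodType R) (p : M -> D),
    [/\ linear_on A p,
        forall d, exists2 x, A x & p x = d &
        forall x, A x -> (p x = 0 <-> Z x)].
Proof.
exists Tl, pi; split.
- by move=> a x y hx hy; rewrite -(pi_add (AZ a hx) hy) -(pi_scale a hx).
- by move=> d; exists (val d); [exact: valA | exact: pi_val].
- move=> x hx; split=> [h|h].
    have := Z_val_pi hx; rewrite h.
    have h0 : Z (val (0 : Tl)).
      have := Z_val_pi (submodule0 hA); rewrite sub0r => /(submoduleN hZ).
      by rewrite opprK.
    by move=> h1; have := submoduleD hZ h1 h0; rewrite subrK.
  by apply: pi_eq; rewrite ?subr0 //; exact: submodule0.
Qed.
End Subquotient.

(** * Extension of homomorphisms *)

(** [bsupp] only has to contain the support; for polynomials it is the list of all indices below the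
    size. *)
Record basis (R : pzRingType) (P : lmodType R) (B : choiceType) := Basis {
  bvec : B -> P;
  coord : P -> B -> R;
  bsupp : P -> seq B;
  bsupp_uniq : forall x, uniq (bsupp x);
  coord_notin : forall x b, b \notin bsupp x -> coord x b = 0;
  coord_lin : forall b a x y, coord (a *: x + y) b = a * coord x b + coord y b;
  coord_bvec : forall b b', coord (bvec b) b' = (b == b')%:R;
  basis_sum : forall x, x = \sum_(b <- bsupp x) coord x b *: bvec b
}.

Section Basis.
Variables (R : pzRingType) (P : lmodType R) (B : choiceType) (E : basis P B).

Lemma coord0 b : coord E 0 b = 0.
Proof. by have := coord_lin E b (-1) 0 0; rewrite scaler0 addr0 mulN1r addNr. Qed.

Lemma coordZ a x b : coord E (a *: x) b = a * coord E x b.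
Proof. by have := coord_lin E b a x 0; rewrite coord0 !addr0. Qed.

Lemma coordD x y b : coord E (x + y) b = coord E x b + coord E y b.
Proof. by have := coord_lin E b 1 x y; rewrite scale1r mul1r. Qed.

Lemma coordN x b : coord E (- x) b = - coord E x b.
Proof. by rewrite -scaleN1r coordZ mulN1r. Qed.

Lemma coordB x y b : coord E (x - y) b = coord E x b - coord E y b.
Proof. by rewrite coordD coordN. Qed.

Lemma sum_bsupp (C : lmodType R) (g : B -> C) x (s : seq B) :
  uniq s -> {subset bsupp E x <= s} ->
  \sum_(b <- s) coord E x b *: g b = \sum_(b <- bsupp E x) coord E x b *: g b.
Proof.
move=> us hs; rewrite (bigID (mem (bsupp E x))) /= addrC big1 ?add0r; last first.
  by move=> b hb; rewrite coord_notin // scale0r.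
rewrite -big_filter; apply: perm_big; apply: uniq_perm.
- exact: filter_uniq.
- exact: bsupp_uniq.
by move=> b; rewrite mem_filter andbC; case hb: (b \in bsupp E x); rewrite ?andbF ?hs.
Qed.

Lemma basis_ext (C : lmodType R) (g : B -> C) :
  exists f : {linear P -> C},
    (forall b, f (bvec E b) = g b) /\
    (forall x, f x = \sum_(b <- bsupp E x) coord E x b *: g b).
Proof.
have [|f hf] := @linear_exists R P C
    (fun x => \sum_(b <- bsupp E x) coord E x b *: g b).
  move=> a x y.
  pose s := undup (bsupp E x ++ bsupp E y ++ bsupp E (a *: x + y)).
  have us : uniq s by exact: undup_uniq.
  rewrite -!(@sum_bsupp _ _ _ s) ?us //; try by move=> b;
    rewrite mem_undup !mem_cat => ->; rewrite ?orbT.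
  rewrite scaler_sumr -big_split /=; apply: eq_bigr => b _.
  by rewrite coord_lin scalerDl scalerA.
exists f; split=> // b; rewrite hf.
rewrite -(@sum_bsupp _ _ _ (undup (b :: bsupp E (bvec E b)))) ?undup_uniq //.
  rewrite (bigD1_seq b) ?undup_uniq ?mem_undup ?mem_head //= coord_bvec eqxx scale1r.
  rewrite big1 ?addr0 // => c /negPf hc.
  by rewrite coord_bvec eq_sym hc scale0r.
by move=> c hc; rewrite mem_undup inE hc orbT.
Qed.

Lemma linear_basis (C : lmodType R) (f : {linear P -> C}) x :
  f x = \sum_(b <- bsupp E x) coord E x b *: f (bvec E b).
Proof.
by rewrite {1}(basis_sum E x) linear_sum; apply: eq_bigr => b _; rewrite linearZ.
Qed.

Lemma basis_lift (M D : lmodType R) (A : M -> Prop) (p : M -> D)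
    (w : {linear P -> D}) :
  submodule A -> linear_on A p -> (forall d, exists2 x, A x & p x = d) ->
  exists l : {linear P -> M}, forall x, A (l x) /\ p (l x) = w x.
Proof.
move=> hA hp hs.
have [g hg] := choice (fun b => let: ex_intro2 x h1 h2 := hs (w (bvec E b)) in
  ex_intro (fun x => A x /\ p x = w (bvec E b)) x (conj h1 h2)).
have [l [lb lE]] := basis_ext g; exists l => x.
rewrite lE (linear_basis w).
elim: (bsupp E x) => [|b s [h1 h2]].
  by rewrite !big_nil (linear_on0 hA hp); split=> //; case: hA.
rewrite !big_cons; have [h3 h4] := hg b; split; first by apply: hA.2.
by rewrite hp // h2 h4.
Qed.
End Basis.

(** For [P] free this amounts to Ext^1(P / K, C) = 0. *)
Definition extends (R : pzRingType) (P : lmodType R) (K : P -> Prop)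
    (C : lmodType R) : Prop :=
  forall u : P -> C, linear_on K u ->
  exists w : {linear P -> C}, forall k, K k -> w k = u k.

(** By the resolution of R[1/r] by two countable free modules, Ext^1(R[1/r], C) is the cokernel of b
    |-> (b n - r b (n+1)) on sequences in [C]. *)
Definition telescopes (R : pzRingType) (r : R) (C : lmodType R) : Prop :=
  forall c : nat -> C, exists b : nat -> C,
    forall n, b n = r *: b n.+1 + c n.

Definition killed_by (R : pzRingType) (J : R -> Prop) (C : lmodType R) : Prop :=
  forall a, J a -> forall c : C, a *: c = 0.

Definition is_ideal (R : pzRingType) (J : R -> Prop) : Prop :=
  submodule (J : R^o -> Prop).

Definition add_principal (R : pzRingType) (J : R -> Prop) (r a : R) : Prop :=
  exists j x, J j /\ a = j + x * r.

Definition extends_mod (R : pzRingType) (P : lmodType R) (K : P -> Prop)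
    (rs : seq R) (J : R -> Prop) : Prop :=
  forall C : lmodType R, (forall r, r \in rs -> telescopes r C) ->
  killed_by J C -> extends K C.

(* When [P / K] is flat, [L P `&` K = L K] for every ideal [L]. *)
Definition pure (R : pzRingType) (P : lmodType R) (B : choiceType)
    (E : basis P B) (K : P -> Prop) : Prop :=
  forall L : R -> Prop, is_ideal L ->
  forall k, K k -> (forall b, L (coord E k b)) ->
  forall H : P -> Prop, submodule H ->
    (forall a x, L a -> K x -> H (a *: x)) -> H k.

(** * Lifting a homomorphism through multiplication by [r] *)

Section LiftMul.
Variables (R : comPzRingType) (P : lmodType R) (B : choiceType) (E : basis P B).
Variables (K : P -> Prop) (J : R -> Prop) (r : R) (rs : seq R).
Hypotheses (hK : submodule K) (hpure : pure E K) (hJ : is_ideal J).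
Hypothesis hQ : extends_mod K rs (add_principal J r).
Variable C : lmodType R.
Hypothesis hJC : killed_by J C.

(** Purity puts [z] in J K, and [u] vanishes there because [J] kills [C]. *)
Lemma pure_killed (u : P -> C) z :
  linear_on K u -> K z -> (forall b, J (coord E z b)) -> u z = 0.
Proof.
move=> hu hz hzJ.
suff [] : K z /\ u z = 0 by [].
apply: (hpure hJ hz hzJ (H := fun x => K x /\ u x = 0)).
  split; first by split; [case: hK | exact: linear_on0 hu].
  move=> a x y [Kx ux] [Ky uy]; split; first exact: hK.2.
  by rewrite hu // ux uy scaler0 addr0.
move=> a x La Kx; split; first exact: submoduleZ.
by rewrite (linear_onZ hK hu) // hJC.
Qed.

Variable u : P -> C.
Hypotheses (hu : linear_on K u) (hdiv : forall k, K k -> exists c, r *: c = u k).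

(** The pullback of [u] along r : C -> C. By [hdiv] it is an extension of [K] by ker r, and its
    splittings are the desired lifts of [u]. *)
Let Y (y : C * P) := K y.2 /\ r *: y.1 = u y.2.
(** Contains (J + (r)) Y, because r (c, k) = (u k, r k) on [Y]; thus Y / JY is killed by
    [add_principal J r]. *)
Let JY (y : C * P) := exists k z, [/\ K k, K z, (forall b, J (coord E z b)) &
  y = (u k, z + r *: k)].

Let subY : submodule Y.
Proof.
split=> [|a x y [h1 h2] [h3 h4]].
  by split=> /=; [case: hK | rewrite scaler0 (linear_on0 hK hu)].
split=> /=; first exact: hK.2.
by rewrite hu // scalerDr h4 -h2 !scalerA mulrC.
Qed.

Let subJY : submodule JY.
Proof.
split=> [|a x y [k [z [h1 h2 h3 ->]]] [k' [z' [h1' h2' h3' ->]]]].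
  exists 0, 0; split; try by case: hK.
    by move=> b; rewrite coord0; case: hJ.
  by rewrite (linear_on0 hK hu) add0r scaler0.
exists (a *: k + k'), (a *: z + z'); split; try exact: hK.2.
  by move=> b; rewrite coord_lin; apply: hJ.2.
rewrite hu //; congr (_, _) => /=.
by rewrite !scalerDr !scalerA mulrC addrACA.
Qed.

Let JY_Y y : JY y -> Y y.
Proof.
move=> [k [z [h1 h2 h3 ->]]]; split=> /=.
  by apply: submoduleD => //; apply: submoduleZ.
have Krk : K (r *: k) by exact: submoduleZ.
rewrite (linear_onD hu h2 Krk).
by rewrite (pure_killed hu h2 h3) add0r (linear_onZ hK hu).
Qed.

(** This embeds ker r into Y / JY. Here r k has coordinates in [J], so purity for the ideal (J : r)
    puts [k] in (J : r) K; the values of [u] are divisible by r, so [u] vanishes there. *)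
Let JY_inj c : JY (c, 0) -> c = 0.
Proof.
move=> [k [z [h1 h2 h3 [-> /esym/eqP]]]]; rewrite addr_eq0 => /eqP hzk.
pose L a := J (r * a).
have hL : is_ideal L.
  split; first by rewrite /L mulr0; case: hJ.
  by move=> a x y hx hy; rewrite /L mulrDr mulrCA; apply: hJ.2.
have hkL b : L (coord E k b).
  rewrite /L -coordZ -[_ *: _]opprK -hzk coordN.
  exact: (submoduleN hJ (h3 b)).
suff [] : K k /\ u k = 0 by [].
apply: (hpure hL h1 hkL (H := fun x => K x /\ u x = 0)).
  split; first by split; [case: hK | exact: linear_on0 hu].
  move=> a x y [Kx ux] [Ky uy]; split; first exact: hK.2.
  by rewrite hu // ux uy scaler0 addr0.
move=> a x La Kx; split; first exact: submoduleZ.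
rewrite (linear_onZ hK hu) //; have [d <-] := hdiv Kx.
by rewrite scalerA mulrC hJC.
Qed.

(** A / Z is the cokernel of ker r, embedded by constant sequences, in the reduced power of Y /
    JY. *)
Let A (s : nat -> C * P) := forall n, Y (s n).
Let Z (s : nat -> C * P) := exists t, r *: t = 0 /\
  exists N, forall n, (N <= n)%N -> JY (s n - (t, 0)).

Let subA : submodule A.
Proof.
split=> [n|a x y hx hy n]; first by case: subY.
exact: subY.2.
Qed.

Let subZ : submodule Z.
Proof.
split=> [|a x y [t [ht [N h]]] [t' [ht' [N' h']]]].
  exists 0; split; first by rewrite scaler0.
  by exists 0%N => n _; rewrite subr0; case: subJY.
exists (a *: t + t'); split.
  by rewrite scalerDr ht' addr0 scalerA mulrC -scalerA ht scaler0.
exists (maxn N N') => n; rewrite geq_max => /andP [hn hn'].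
have -> : (a *: x + y) n - (a *: t + t', 0) =
  a *: (x n - (t, 0)) + (y n - (t', 0)).
  have -> : (a *: t + t', 0) = a *: (t, 0) + (t', 0) :> C * P.
    by congr (_, _); rewrite /= scaler0 addr0.
  by rewrite scalerBr opprD addrACA.
by apply: subJY.2; [exact: h | exact: h'].
Qed.

Let eventually0 (s : nat -> C * P) N : (forall n, (N <= n)%N -> s n = 0) -> Z s.
Proof.
move=> h; exists 0; split; first by rewrite scaler0.
by exists N => n hn; rewrite h // subr0; case: subJY.
Qed.

(* Sequences modulo eventual equality form a reduced power, in which every
   telescoping system is solvable because its finite truncations are; it
   plays the role of an injective module. *)
Lemma lift_mul :
  exists v : P -> C, linear_on K v /\ forall k, K k -> r *: v k = u k.
Proof.
have [D [p [hp surjp kerp]]] := subquotient subA subZ.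
have peq x y : A x -> A y -> Z (x - y) -> p x = p y.
  move=> hx hy hxy; apply/eqP; rewrite -subr_eq0 -(linear_onB subA hp) //.
  by apply/eqP; apply: (kerp _ (submoduleB subA hx hy)).2.
have telD s : telescopes s D.
  move=> c.
  have [y hy] := choice (fun n => let: ex_intro2 x h1 h2 := surjp (c n) in
    ex_intro (fun x => A x /\ p x = c n) x (conj h1 h2)).
  (* Component [k] solves the system cut off after equation [k]; equation [n] then holds from
     component [n] on, which suffices in [D]. *)
  pose b n k : C * P := \sum_(n <= j < k.+1) s ^+ (j - n) *: y j k.
  have Ab n : A (b n).
    move=> k; apply: submodule_sum => // i _; apply: submoduleZ => //.
    exact: (hy i).1.
  exists (fun n => p (b n)) => n; have [Ay <-] := hy n.
  rewrite -hp //; apply: peq => //; first exact: subA.2.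
  apply: (@eventually0 _ n) => k hk.
  change (b n k - (s *: b n.+1 k + y n k) = 0).
  apply/eqP; rewrite subr_eq0; apply/eqP.
  rewrite /b big_ltn // subnn expr0 scale1r addrC; congr (_ + _).
  rewrite /= scaler_sumr; apply: eq_big_nat => j /andP [hj _].
  by rewrite scalerA -exprS -subSn // subSS.
have killD : killed_by (add_principal J r) D.
  move=> _ [j [x [hj ->]]] d; have [y hy <-] := surjp d.
  rewrite -(linear_onZ subA hp) //; apply: (kerp _ (submoduleZ subA _ hy)).2.
  exists 0; split; first by rewrite scaler0.
  exists 0%N => n _; rewrite subr0; have [Ky ry] := hy n.
  exists (x *: (y n).2), (j *: (y n).2); split; try by apply: submoduleZ.
    by move=> b; rewrite coordZ mulrC; exact: (submoduleZ hJ (coord E (y n).2 b) hj).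
  rewrite (linear_onZ hK hu) // -ry [LHS]surjective_pairing /=; congr (_, _).
    by rewrite scalerDl hJC // add0r scalerA.
  by rewrite scalerDl scalerA [r * x]mulrC.
have [k|sc hsc] := @choice _ _ (fun k c => K k -> r *: c = u k).
  have [hk|hk] := pselect (K k); last by exists 0.
  by have [c hc] := hdiv hk; exists c.
(* Two choices of [sc k] differ by an element of ker r, which [Z] absorbs, so k |-> p (cst k) is
   linear although [sc] is not. Its connecting image is the class of the extension [Y]; extending it
   to the free module [P] kills that class. *)
pose cst k : nat -> C * P := fun _ => (sc k, k).
have Acst k : K k -> A (cst k) by move=> hk n; split=> //; exact: hsc.
have mulin : linear_on K (fun k => p (cst k)).
  move=> a x y hx hy; have hxy := hK.2 a _ _ hx hy.
  rewrite -hp; try exact: Acst.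
  apply: peq; [exact: Acst | by apply: subA.2; exact: Acst |].
  exists (sc (a *: x + y) - (a *: sc x + sc y)); split.
    rewrite scalerBr hsc // scalerDr scalerA mulrC -scalerA !hsc //.
    by rewrite hu // subrr.
  exists 0%N => n _; suff -> : (cst (a *: x + y) - (a *: cst x + cst y)) n -
    (sc (a *: x + y) - (a *: sc x + sc y), 0) = 0 by case: subJY.
  rewrite [LHS]surjective_pairing /=; congr (_, _); first by rewrite subrr.
  by rewrite subrr subr0.
have [w hw] := hQ (fun s _ => telD s) killD mulin.
have [l hl] := basis_lift E w subA hp surjp.
(* Correcting [sc k] by the element of ker r found in [Z] gives a value for [v k]. It is unique by
   [JY_inj], and linearity follows from uniqueness. *)
pose rel k x := exists N, forall n, (N <= n)%N -> JY ((x, k) - l k n).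
have [k|v hv] := @choice _ _ (fun k c => K k -> rel k c).
  have [hk|hk] := pselect (K k); last by exists 0.
  have [Al pl] := hl k.
  have h0 : p (cst k - l k) = 0.
    by rewrite (linear_onB subA hp) ?pl ?hw ?subrr //; exact: Acst.
  have [] := (kerp _ (submoduleB subA (Acst _ hk) Al)).1 h0.
  move=> t [ht [N hN]]; exists (sc k - t) => _; exists N => n /hN.
  congr JY; rewrite /= [RHS]addrC -[LHS]addrA [- l k n + _]addrC addrA.
  rewrite [RHS]addrC; congr (_ - _).
  by rewrite [LHS]surjective_pairing /=; rewrite subr0.
have rel_uniq k x y : rel k x -> rel k y -> x = y.
  move=> [N hN] [N' hN']; apply/eqP; rewrite -subr_eq0; apply/eqP/JY_inj.
  have h1 := hN (maxn N N') (leq_maxl _ _).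
  have h2 := hN' (maxn N N') (leq_maxr _ _).
  have -> : (x - y, 0) = ((x, k) - l k (maxn N N')) - ((y, k) - l k (maxn N N')).
    by rewrite opprB addrA subrK; congr (_, _); rewrite /= subrr.
  exact: (submoduleB subJY h1 h2).
exists v; split.
  move=> a x y hx hy; apply: (@rel_uniq (a *: x + y)).
    exact/hv/hK.2.
  have [N hN] := hv _ hx; have [N' hN'] := hv _ hy.
  exists (maxn N N') => n; rewrite geq_max => /andP [hn hn'].
  have := subJY.2 a _ _ (hN n hn) (hN' n hn').
  congr JY; rewrite linearP scalerBr addrACA -opprD; congr (_ - _).
move=> k hk; have [N hN] := hv _ hk.
have h := submoduleD subY (JY_Y (hN N (leqnn N))) ((hl k).1 N).
by move: h; rewrite subrK => -[].
Qed.
End LiftMul.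

(** * Free after inverting one element *)

Lemma wf_fixpoint (B X : Type) (lt : B -> B -> Prop)
    (F : (B -> X) -> B -> X) (x0 : X) :
  well_founded lt ->
  (forall f g b, (forall c, lt c b -> f c = g c) -> F f b = F g b) ->
  exists f, forall b, f b = F f b.
Proof.
move=> wf hF.
pose G b (rec : forall c, lt c b -> X) :=
  F (fun c => if pselect (lt c b) is left h then rec c h else x0) b.
exists (Fix wf _ G) => b; rewrite Fix_eq.
  by apply: hF => c hc; case: pselect.
by move=> c f g hfg; apply: hF => d hd; case: pselect.
Qed.

Section MainStep.
Variables (R : comPzRingType) (P : lmodType R) (B : choiceType) (E : basis P B).
Variables (K : P -> Prop) (J : R -> Prop) (r : R) (rs : seq R).
Hypotheses (hK : submodule K) (hpure : pure E K) (hJ : is_ideal J).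
Hypothesis hQ : extends_mod K rs (add_principal J r).

Section Divide.
Variable C : lmodType R.
Hypotheses (hJC : killed_by J C) (htel : forall s, s \in rs -> telescopes s C).

(** In Ext^1(P / K, C) the class of [u] is r times that of [q.1]. Modulo r C, [u] extends to [P];
    subtracting a lift of this extension leaves values in r C, to which [lift_mul] applies. *)
Lemma divide_hom (u : P -> C) : linear_on K u ->
  exists q : (P -> C) * {linear P -> C},
    linear_on K q.1 /\ forall k, K k -> u k = r *: q.1 k + q.2 k.
Proof.
move=> hu; pose Z (c : C) := exists d, c = r *: d.
have subZ : submodule Z.
  split=> [|a x y [d ->] [d' ->]]; first by exists 0; rewrite scaler0.
  by exists (a *: d + d'); rewrite scalerDr !scalerA mulrC.
have [D [p [hp surjp kerp]]] := subquotient (submoduleT C) subZ.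
have pZ c : p (r *: c) = 0 by apply/kerp => //; exists c.
have killD : killed_by (add_principal J r) D.
  move=> _ [j [x [hj ->]]] d; have [y _ <-] := surjp d.
  rewrite -(linear_onZ (submoduleT C) hp) // scalerDl hJC // add0r mulrC.
  by rewrite -scalerA pZ.
have telD s : s \in rs -> telescopes s D.
  move=> hs c.
  have [y hy] := choice (fun n => let: ex_intro2 x h1 h2 := surjp (c n) in
    ex_intro (fun x => p x = c n) x h2).
  by have [b hb] := htel hs y; exists (p \o b) => n /=; rewrite hb hp // hy.
have hpu : linear_on K (p \o u) by move=> a x y hx hy /=; rewrite hu // hp.
have [w hw] := hQ telD killD hpu.
have [v hv] := basis_lift E w (submoduleT C) hp surjp.
pose u1 x := u x - v x.
have hu1 : linear_on K u1.
  by move=> a x y hx hy; rewrite /u1 hu // linearP scalerBr opprD addrACA.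
have hdiv k : K k -> exists c, r *: c = u1 k.
  move=> hk; suff /(kerp _ I) [c ->] : p (u1 k) = 0 by exists c.
  by rewrite (linear_onB (submoduleT C) hp) // (hv k).2 hw ?subrr.
have [u' [hu' hru']] := lift_mul hK hpure hJ hQ hJC hu1 hdiv.
by exists (u', v); split=> // k hk /=; rewrite hru' // subrK.
Qed.
End Divide.

Variables (lt : rel B) (std : B -> Prop) (kb : B -> P).
Hypothesis lt_wf : well_founded lt.
(** Modulo [J], the relation [kb b] has leading term r b; [std] singles out the monomials that lead
    no such relation. *)
Hypothesis kbP : forall b, ~ std b ->
  [/\ K (kb b), J (coord E (kb b) b - r) &
      forall c, c != b -> ~ J (coord E (kb b) c) -> lt c b].
(** The [kb b] generate [K] modulo [J] after inverting [r], phrased as an induction principle so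
    that no localization has to be formed. *)
Hypothesis K_gen : forall H : P -> Prop, submodule H ->
  (forall k, K k -> (forall b, J (coord E k b)) -> H k) ->
  (forall b, ~ std b -> H (kb b)) ->
  (forall k, K k -> H (r *: k) -> H k) ->
  forall k, K k -> H k.

Let low b := kb b - r *: bvec E b.

Let lowE (C : lmodType R) (f : {linear P -> C}) b : killed_by J C -> ~ std b ->
  f (low b) = \sum_(c <- bsupp E (low b) | lt c b)
                 coord E (low b) c *: f (bvec E c).
Proof.
move=> hC hb; rewrite (linear_basis E) [RHS]big_mkcond; apply: eq_bigr => c _.
case: ifP => // hc; have [_ h1 h2] := kbP hb.
apply: hC; have [->|ncb] := eqVneq c b.
  by rewrite coordB coordZ coord_bvec eqxx mulr1.
rewrite coordB coordZ coord_bvec eq_sym (negPf ncb) mulr0 subr0.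
by apply: contrapT => /(h2 _ ncb); rewrite hc.
Qed.

(* [Ext^1(F, C)] is [r]-divisible by [divide_hom], so a class [u] starts a
   sequence [U n = r U (n+1) + V n]; the maps [w n] below split the extension of
   [F[1/r]] that this sequence defines, using that [F[1/r]] is free on the
   standard basis vectors. *)
Lemma extends_mod_step : extends_mod K (r :: rs) J.
Proof.
move=> C htel hJC u0 hu0.
have htel' s : s \in rs -> telescopes s C.
  by move=> hs; apply: htel; rewrite inE hs orbT.
have [u|phi hphi] := @choice _ _ (fun (u : P -> C) q => linear_on K u ->
    linear_on K q.1 /\
    forall k, K k -> u k = r *: q.1 k + (q.2 : {linear P -> C}) k).
  have [hu|hu] := pselect (linear_on K u).
    by have [q hq] := divide_hom hJC htel' hu; exists q.
  by have [z _] := basis_ext E (fun=> 0 : C); exists (fun=> 0, z).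
pose U := fix U n := if n is n'.+1 then (phi (U n')).1 else u0.
pose V n : {linear P -> C} := (phi (U n)).2.
have linU n : linear_on K (U n).
  by elim: n => //= n IH; case: (hphi _ IH).
have UE n k : K k -> U n k = r *: U n.+1 k + V n k.
  by move=> hk; case: (hphi _ (linU n)) => _ /(_ _ hk).
have [b|sg hsg] := @choice _ _ (fun b (s : nat -> C) =>
    forall n, s n = r *: s n.+1 + V n (bvec E b)).
  have hr : r \in r :: rs by rewrite mem_head.
  by have [s hs] := htel r hr (fun n => V n (bvec E b)); exists s.
(* On a standard vector no relation constrains the values, and the sequence [sg b] serves. On any
   other vector the formula results from eliminating r W b (n+1) between w n = r w (n+1) + V n and w
   (n+1) (kb b) = U (n+1) (kb b), so nothing is divided by [r]. *)
pose F (f : B -> nat -> C) b : nat -> C :=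
  if pselect (std b) then sg b else fun n =>
    U n.+1 (kb b) - \sum_(c <- bsupp E (low b) | lt c b)
      coord E (low b) c *: f c n.+1 + V n (bvec E b).
have [W hW] : exists W, forall b, W b = F W b.
  apply: (wf_fixpoint (fun=> 0) lt_wf) => f g b hfg; rewrite /F.
  case: pselect => // hn; apply/funext => n; congr (_ - _ + _).
  by apply: eq_bigr => c hc; rewrite hfg.
have [n|w hw] := @choice _ _ (fun n (w : {linear P -> C}) =>
    forall b, w (bvec E b) = W b n).
  by have [w [hw _]] := basis_ext E (fun b => W b n); exists w.
have Wnstd b n : ~ std b ->
    W b n = U n.+1 (kb b) - w n.+1 (low b) + V n (bvec E b).
  move=> hb; rewrite {1}hW /F; case: pselect => // nsb.
  by rewrite lowE //; congr (_ - _ + _); apply: eq_bigr => c _; rewrite hw.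
have kbE b : kb b = r *: bvec E b + low b by rewrite addrC subrK.
have VE b n : V n (kb b) = r *: V n (bvec E b) + V n (low b).
  by rewrite {1}kbE linearP.
have key b n : ~ std b ->
    (forall c, lt c b -> forall n, W c n = r *: W c n.+1 + V n (bvec E c)) ->
    r *: W b n = U n (kb b) - w n (low b).
  move=> hb IH; have [Kb _ _] := kbP hb.
  rewrite Wnstd // scalerDr scalerBr [U n _]UE // VE.
  have -> : w n (low b) = r *: w n.+1 (low b) + V n (low b).
    rewrite !lowE // scaler_sumr -big_split /=; apply: eq_bigr => c hc.
    by rewrite !hw IH // scalerDr !scalerA mulrC.
  by rewrite [in RHS]addrA [in RHS]opprD [in RHS]addrACA subrr addr0 addrAC.
have WE b n : W b n = r *: W b n.+1 + V n (bvec E b).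
  elim/(well_founded_ind lt_wf): b => b IH in n *.
  have [hb|hb] := pselect (std b).
    by rewrite hW /F; case: pselect => // hs; exact: hsg.
  by rewrite key // Wnstd.
have wE x n : w n x = r *: w n.+1 x + V n x.
  rewrite !(linear_basis E) scaler_sumr -big_split /=; apply: eq_bigr => b _.
  by rewrite !hw WE scalerDr !scalerA mulrC.
exists (w 0%N) => k hk.
(* All [n] are carried along because cancelling [r] derives the equality at [n] from the one at
   [n.+1]. *)
suff [_ ->] : K k /\ forall n, w n k = U n k by [].
apply: (K_gen (H := fun x => K x /\ forall n, w n x = U n x)) k hk => //.
- split=> [|a x y [Kx hx] [Ky hy]].
    by split=> [|n]; [case: hK | rewrite linear0 (linear_on0 hK (linU n))].
  by split=> [|n]; [exact: hK.2 | rewrite linearP hx hy linU].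
- move=> k hk hkJ; split=> // n.
  rewrite (pure_killed hK hpure hJ hJC (linU n) hk hkJ) (linear_basis E).
  by rewrite big1 // => b _; exact: hJC.
- move=> b hb; have [Kb _ _] := kbP hb; split=> // n.
  rewrite [X in w n X]kbE linearP hw key ?subrK // => c _ m; exact: WE.
- move=> k hk [_ h]; split=> // n; rewrite wE UE //; congr (_ + _).
  by have := h n.+1; rewrite linearZ (linear_onZ hK (linU n.+1)).
Qed.
End MainStep.

(** * Extensions and flatness through a free presentation *)

Lemma ideal_add_principal (R : comPzRingType) (J : R -> Prop) r :
  is_ideal J -> is_ideal (add_principal J r).
Proof.
move=> hJ; split=> [|a x y [j [c [hj ->]]] [j' [c' [hj' ->]]]].
  by exists 0, 0; split; [case: hJ | rewrite mul0r addr0].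
exists (a * j + j'), (a * c + c'); split; first exact: hJ.2.
by rewrite [_ *: _]mulrDr mulrDl mulrA addrACA.
Qed.

Section Presented.
Variables (R : comPzRingType) (P F : lmodType R) (B : choiceType).
Variables (E : basis P B) (pr : {linear P -> F}).
Hypothesis pr_surj : forall m, exists x, pr x = m.

Let K x := pr x = 0.

Lemma submodule_ker : submodule K.
Proof.
split=> [|a x y]; rewrite /K ?linear0 // linearP => -> ->.
by rewrite scaler0 addr0.
Qed.

(** A lift P -> X of [pr] maps [K] into [C]. Subtracting an extension to [P] of this restriction
    makes the lift factor through [F]. *)
Lemma extends_Ext1 (C : lmodType R) : extends K C -> Ext1_vanishes F C.
Proof.
move=> ext X i p inj_i surj_p exact_p.
have linp : linear_on (fun=> True) p by move=> a x y _ _; rewrite linearP.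
have surj' d : exists2 x, True & p x = d by have [x hx] := surj_p d; exists x.
have [g hg] := basis_lift E pr (submoduleT X) linp surj'.
have [k|u hu] := @choice _ _ (fun k c => K k -> i c = g k).
  have [hk|hk] := pselect (K k); last by exists 0.
  by have [c hc] := (exact_p (g k)).1 (etrans (hg k).2 hk); exists c.
have linu : linear_on K u.
  move=> a x y hx hy; apply: inj_i; rewrite linearP !hu // ?linearP //.
  exact: submodule_ker.2.
have [w hw] := ext u linu.
have [pk hpk] := choice pr_surj.
have [|sg hsg] := @linear_exists R P X (fun x => g x - i (w x)).
  by move=> a x y; rewrite !linearP scalerDr addrACA.
have sK k : K k -> sg k = 0 by move=> hk; rewrite hsg hw // hu // subrr.
have [|sl hsl] := @linear_exists R F X (sg \o pk).
  move=> a x y /=; apply/eqP; rewrite -linearP -subr_eq0 -linearB sK //.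
  by rewrite /K linearB linearP !hpk subrr.
exists sl => m; rewrite hsl /= hsg linearB (hg _).2 hpk.
have -> : p (i (w (pk m))) = 0 by apply/exact_p; exists (w (pk m)).
by rewrite subr0.
Qed.

(** The tensor with terms coord k b (x) pr (bvec b) in L (x) F maps to pr k = 0 in F, so it vanishes
    by flatness. The pairing of a in [L] with m in [F] into P / LK, a times any lift of m, is well
    defined because L K lies in [LK]; it sends this tensor to the class of [k]. *)
Lemma flat_pure : flat F -> pure E K.
Proof.
move=> flatF L hL k Kk hk.
suff hLK : forall (LK : P -> Prop), submodule LK ->
  (forall a x, L a -> K x -> LK (a *: x)) -> LK k by [].
move=> LK subLK hLK.
have [N [q [linq surjq kerq]]] := subquotient hL (submodule_eq0 R^o).
have [f0 hf0] := choice (fun n => let: ex_intro2 x h1 h2 := surjq n in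
    ex_intro (fun x => L x /\ q x = n) x (conj h1 h2)).
have f0q a : L a -> f0 (q a) = a.
  move=> La; have [h1 h2] := hf0 (q a); apply/eqP; rewrite -subr_eq0; apply/eqP.
  apply/(kerq _ (submoduleB hL h1 La)).
  by rewrite (linear_onB hL linq) // h2 subrr.
have [|f hf] := @linear_exists R N R^o f0.
  move=> a x y; have [h1 h2] := hf0 x; have [h3 h4] := hf0 y.
  by rewrite -{1}h2 -{1}h4 -linq // f0q //; exact: hL.2.
have inj_f : injective f.
  by move=> x y; rewrite !hf => h; rewrite -(hf0 x).2 h (hf0 y).2.
have [Q [t [lint _ kert]]] := subquotient (submoduleT P) subLK.
have [pk hpk] := choice pr_surj.
have tLK a x y : L a -> K (x - y) -> a *: t x = a *: t y.
  move=> La hxy; apply/eqP; rewrite -subr_eq0 -scalerBr.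
  rewrite -(linear_onB (submoduleT P) lint) // -(linear_onZ (submoduleT P) lint) //.
  by apply/eqP/(kert _ I); exact: hLK.
pose s := [seq (q (coord E k b), pr (bvec E b)) | b <- bsupp E k].
have := flatF N R^o f inj_f s; rewrite /tensor_zero => /(_ _ Q).
move=> /(_ _ (fun n m => f0 n *: t (pk m))) h.
apply/(kert _ I); rewrite (basis_sum E k).
have -> : t (\sum_(b <- bsupp E k) coord E k b *: bvec E b) =
   \sum_(b <- bsupp E k) coord E k b *: t (bvec E b).
  elim: (bsupp E k) => [|b l IH].
    by rewrite !big_nil (linear_on0 (submoduleT P) lint).
  by rewrite !big_cons lint // IH.
rewrite -[RHS]h.
- rewrite big_map; apply: eq_bigr => b _ /=; rewrite f0q //; apply: tLK => //.
  by rewrite /K linearB hpk subrr.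
- move=> Q' b [b1 b2]; rewrite !big_map /=.
  have b10 m : b 0 m = 0.
    by have := b1 m (-1) 0 0; rewrite scaler0 addr0 scaleN1r addNr.
  have b1Z m a x : b (a *: x) m = a *: b x m.
    by have := b1 m a x 0; rewrite !addr0 b10 addr0.
  have b20 n : b n 0 = 0.
    by have := b2 n (-1) 0 0; rewrite scaler0 addr0 scaleN1r addNr.
  transitivity (b 1 (pr k)); last by rewrite Kk b20.
  rewrite (linear_basis E).
  elim: (bsupp E k) => [|c l IH]; first by rewrite !big_nil b20.
  rewrite !big_cons b2 IH; congr (_ + _); rewrite -b1Z hf f0q //.
  by congr b; rewrite [RHS]mulr1.
- split=> [m a x y|n a x y].
    have [h1 h2] := hf0 x; have [h3 h4] := hf0 y.
    by rewrite -!hf linearP scalerDl scalerA.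
  rewrite scalerA mulrC -scalerA -scalerDr -lint //; apply: tLK.
    by have [] := hf0 n.
  by rewrite /K linearB linearP !hpk subrr.
Qed.
End Presented.

(** * Contraadjusted modules *)

Section PolyBasis.
Variable R : comNzRingType.

Definition poly_basis : basis ({poly R} : lmodType R) (nat : choiceType).
Proof.
apply: (@Basis _ _ _ (fun i => 'X^i : {poly R}) (fun p i => p`_i)
  (fun p => iota 0 (size p))).
- by move=> p; exact: iota_uniq.
- by move=> p i; rewrite mem_iota add0n /= -leqNgt => /leq_sizeP; exact.
- by move=> i a p q; rewrite coefD coefZ.
- by move=> i j; rewrite coefXn eq_sym.
- move=> p; rewrite -{1}[p]coefK poly_def.
  by rewrite -(big_mkord xpredT (fun i => p`_i *: 'X^i)) /index_iota subn0.
Defined.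
End PolyBasis.

(* [R[1/r]] is realised as [R['X] / (1 - r 'X)], and a sequence [c] in [C]
   twists it into the extension in which ['X^n = r 'X^(n+1) + c n]. *)
Section Telescope.
Variables (R : comNzRingType) (r : R) (C : lmodType R).

Let d : {poly R} := 1 - r *: 'X.

(** [q] is the power series a / (1 - r 'X). Being a polynomial, it forces r ^+ n * a = 0 for large
    [n], which is the kernel condition of the localization. *)
Let coef_mul_d q n a : a%:P = q * d -> q`_n = r ^+ n * a.
Proof.
move=> h; elim: n => [|n IH].
  have := congr1 (fun p : {poly R} => p`_0) h.
  rewrite /d /= coefC eqxx mulrBr mulr1 coefB -scalerAr coefZ coefMX.
  by rewrite mulr0 subr0 mul1r.
have := congr1 (fun p : {poly R} => p`_n.+1) h.
rewrite /d /= coefC /= mulrBr mulr1 coefB -scalerAr coefZ coefMX /= => /esym/eqP.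
by rewrite subr_eq0 => /eqP ->; rewrite IH exprS mulrA.
Qed.

Let mul_d_eq0 q : q * d = 0 -> q = 0.
Proof.
move=> h; apply/polyP => n; rewrite coef0.
by rewrite (@coef_mul_d q n 0) ?mulr0 // h.
Qed.

Let Zd (p : {poly R}) := exists q, p = q * d.

Let ZdX p : Zd (p - r *: (p * 'X)).
Proof. by exists p; rewrite mulrBr mulr1 scalerAr. Qed.

Let Zd_r p : Zd (r *: p) -> Zd p.
Proof.
move=> [q h]; exists (p + q * 'X).
rewrite mulrDl mulrAC -h /d mulrBr mulr1 -scalerAr -scalerAl.
by rewrite subrK.
Qed.

Variables (L : lmodType R) (pl : {poly R} -> L).
Hypotheses (linl : linear_on (fun=> True) pl).
Hypotheses (surjl : forall m, exists2 x, True & pl x = m).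
Hypotheses (kerl : forall x, True -> (pl x = 0 <-> Zd x)).

Let T := submoduleT {poly R}.

Let pl_eq x y : Zd (x - y) -> pl x = pl y.
Proof.
move=> h; apply/eqP; rewrite -subr_eq0 -(linear_onB T linl) //.
by apply/eqP/kerl.
Qed.

Let plX p : pl p = r *: pl (p * 'X).
Proof. by rewrite -(linear_onZ T linl) //; exact/pl_eq/ZdX. Qed.

Let r_inj (m : L) : r *: m = 0 -> m = 0.
Proof.
have [p _ <-] := surjl m; rewrite -(linear_onZ T linl) //.
by move=> /(kerl _ I).1 /Zd_r h; exact: (kerl _ I).2.
Qed.

Lemma poly_localization : is_localization_at r (pl 1).
Proof.
split.
- move=> x y /= /eqP; rewrite -subr_eq0 -scalerBr => /eqP /r_inj /eqP.
  by rewrite subr_eq0 => /eqP.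
- by move=> x; have [p _ <-] := surjl x; exists (pl (p * 'X)); rewrite -plX.
- move=> x; have [p _ <-] := surjl x; elim/poly_ind: p => [|p c [n [a h]]].
    by exists 0%N, 0; rewrite (linear_on0 T linl) scaler0 scale0r.
  exists n.+1, (a + r ^+ n.+1 * c).
  rewrite (linear_onD linl) // scalerDr exprSr -scalerA -plX h scalerDl.
  congr (_ + _); rewrite -alg_polyC (linear_onZ T linl) //.
  by rewrite scalerA.
- move=> a; rewrite -(linear_onZ T linl) // kerl //; split=> [[q h]|[n h]].
    exists (size q); rewrite -(@coef_mul_d q); first by rewrite nth_default.
    by rewrite -h alg_polyC.
  apply/(kerl _ I); rewrite (linear_onZ T linl) //.
  have : r ^+ n *: (a *: pl 1) = 0 by rewrite scalerA h scale0r.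
  elim: n {h} => [|n IH]; first by rewrite scale1r.
  by rewrite exprS -scalerA => /r_inj.
Qed.

Lemma Ext1_telescopes : Ext1_vanishes L C -> telescopes r C.
Proof.
move=> ext c.
have [xi [xiX _]] := basis_ext (poly_basis R) c.
pose Ze (x : {poly R} * C) := exists q, x = (q * d, xi q).
have subZe : submodule Ze.
  split=> [|a x y [p ->] [q ->]]; first by exists 0; rewrite mul0r linear0.
  by exists (a *: p + q); rewrite mulrDl -scalerAl linearP.
have T2 := submoduleT ({poly R} * C)%type.
have [X [pe [linE surjE kerE]]] := subquotient T2 subZe.
have pe_pl x y : pe x = pe y -> pl x.1 = pl y.1.
  move=> /eqP; rewrite -subr_eq0 -(linear_onB T2 linE) // => /eqP.
  by move=> /(kerE _ I).1 [q] [h _]; apply: pl_eq; exists q.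
have [|i hi] := @linear_exists R C X (fun x => pe (0, x)).
  by move=> a x y; rewrite -linE //; congr pe; congr (_, _); rewrite /= scaler0 addr0.
have [pk hpk] := choice (fun m => let: ex_intro2 x h1 h2 := surjE m in
    ex_intro (fun x => pe x = m) x h2).
have [|p hp] := @linear_exists R X L (fun m => pl (pk m).1).
  move=> a x y; rewrite -linl //; apply: (pe_pl _ (a *: pk x + pk y)).
  by rewrite linE // !hpk.
have p_pe x : p (pe x) = pl x.1 by rewrite hp; apply: pe_pl; rewrite hpk.
have inj_i : injective i.
  move=> x y /eqP; rewrite -subr_eq0 -linearB hi => /eqP /(kerE _ I).1 [q [h1 h2]].
  by apply/eqP; rewrite -subr_eq0 h2 (mul_d_eq0 (esym h1)) linear0.
have [||s hs] := ext X i p inj_i.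
- by move=> m; have [x _ <-] := surjl m; exists (pe (x, 0)); rewrite p_pe.
- move=> m; have [[x z] _ <-] := surjE m; split=> [|[e ->]].
    rewrite p_pe => /(kerl _ I).1 [q /= ->]; exists (z - xi q); rewrite hi.
    apply/eqP; rewrite -subr_eq0 -(linear_onB T2 linE) //.
    apply/eqP/kerE => //; exists q; congr (_, _) => /=; first by rewrite subr0.
    by rewrite opprB addrC subrK.
  by rewrite hi p_pe (linear_on0 T linl).
(* The section sends the class of 'X^n to a lift of it, shifted by some [b n] in [C]; linearity
   along 'X^n = r 'X^(n+1) in [L] becomes the telescoping system. *)
have sX n : exists b, s (pl 'X^n) = pe ('X^n, b).
  have [[x z] _ h] := surjE (s (pl 'X^n)).
  have := hs (pl 'X^n); rewrite -h.
  rewrite p_pe /= => /eqP; rewrite -subr_eq0 -(linear_onB T linl) // => /eqP.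
  move=> /(kerl _ I).1 [q hq]; exists (z - xi q).
  apply/eqP; rewrite -subr_eq0 -(linear_onB T2 linE) //.
  apply/eqP/kerE => //; exists q; congr (_, _) => //=.
  by rewrite opprB addrC subrK.
have [b hb] := choice sX; exists b => n.
have : s (pl 'X^n) = r *: s (pl 'X^(n.+1)).
  by rewrite [in LHS]plX linearZ -exprSr.
rewrite !hb -(linear_onZ T2 linE) // => /eqP.
rewrite -subr_eq0 -(linear_onB T2 linE) // => /eqP /(kerE _ I).1 [q [h1 h2]].
have hq : q = 'X^n.
  apply/eqP; rewrite -subr_eq0; apply/eqP/mul_d_eq0.
  by rewrite mulrBl -h1 /d mulrBr mulr1 -scalerAr -exprSr subrr.
move: h2; rewrite hq (xiX n) => /eqP.
by rewrite subr_eq addrC => /eqP.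
Qed.
End Telescope.

Lemma contraadjusted_telescopes (R : comNzRingType) (rs : seq R) (C : lmodType R) :
  contraadjusted rs C -> forall r, r \in rs -> telescopes r C.
Proof.
move=> h r hr.
have subZ : submodule (fun p : {poly R} => exists q, p = q * (1 - r *: 'X)).
  split=> [|a x y [p ->] [q ->]]; first by exists 0; rewrite mul0r.
  by exists (a *: p + q); rewrite mulrDl scalerAl.
have [L [pl [l1 l2 l3]]] := subquotient (submoduleT {poly R}) subZ.
exact: (Ext1_telescopes l1 l2 l3 (h r hr L _ (poly_localization l1 l2 l3))).
Qed.

(** * Noetherian rings *)

Definition ideal_gen (A : pzRingType) (S : A -> Prop) (x : A) : Prop :=
  forall I, is_ideal I -> (forall y, S y -> I y) -> I x.

Definition before (T : Type) (a : nat -> T) (n : nat) (y : T) : Prop :=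
  exists2 i, (i < n)%N & y = a i.

(** The ascending chain condition stated on generators, the form in which sequences built by
    dependent choice contradict it. *)
Definition noetherian (A : pzRingType) : Prop :=
  forall a : nat -> A, exists n, ideal_gen (before a n) (a n).

Section IdealGen.
Variable A : pzRingType.
Implicit Types (S : A -> Prop) (a : nat -> A).

Lemma idealD (I : A -> Prop) x y : is_ideal I -> I x -> I y -> I (x + y).
Proof. by move=> hI hx hy; exact: (submoduleD hI hx hy). Qed.

Lemma idealN (I : A -> Prop) x : is_ideal I -> I x -> I (- x).
Proof. by move=> hI hx; exact: (submoduleN hI hx). Qed.

Lemma idealM (I : A -> Prop) x y : is_ideal I -> I y -> I (x * y).
Proof. by move=> hI hy; exact: (submoduleZ hI x hy). Qed.

Lemma ideal_gen_ideal S : is_ideal (ideal_gen S).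
Proof.
split=> [I hI _|a x y hx hy I hI hS]; first by case: hI.
by apply: hI.2; [exact: hx | exact: hy].
Qed.

Lemma mem_ideal_gen S x : S x -> ideal_gen S x.
Proof. by move=> hx I _; exact. Qed.

Lemma ideal_gen_sub S S' x :
  (forall y, S y -> ideal_gen S' y) -> ideal_gen S x -> ideal_gen S' x.
Proof. by move=> h; apply=> //; exact: ideal_gen_ideal. Qed.

Lemma ideal_gen_before a m n x : (m <= n)%N ->
  ideal_gen (before a m) x -> ideal_gen (before a n) x.
Proof.
move=> mn; apply: ideal_gen_sub => y [i hi ->]; apply: mem_ideal_gen.
by exists i => //; exact: leq_trans mn.
Qed.

Lemma ideal_union_before a :
  is_ideal (fun x => exists n, ideal_gen (before a n) x).
Proof.
split=> [|c x y [n hx] [m hy]].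
  by exists 0%N; case: (ideal_gen_ideal (before a 0)).
exists (maxn n m); apply: (ideal_gen_ideal _).2.
  by apply: ideal_gen_before hx; exact: leq_maxl.
by apply: ideal_gen_before hy; exact: leq_maxr.
Qed.

Lemma noetherian_ind : noetherian A ->
  forall Q : (A -> Prop) -> Prop,
  (forall I, is_ideal I ->
    (forall I', is_ideal I' -> (forall x, I x -> I' x) ->
       (exists2 x, I' x & ~ I x) -> Q I') -> Q I) ->
  forall I, is_ideal I -> Q I.
Proof.
move=> hA Q hQ I hI; apply: contrapT => nQ.
have [Ix|nxt hnxt] := @choice _ _ (fun (I : A -> Prop) (q : (A -> Prop) * A) =>
    is_ideal I /\ ~ Q I -> [/\ is_ideal q.1 /\ ~ Q q.1,
      forall x, I x -> q.1 x, q.1 q.2 & ~ I q.2]).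
  have [[h1 h2]|h] := pselect (is_ideal Ix /\ ~ Q Ix); last by exists (Ix, 0).
  apply: contrapT => h3; apply: h2; apply: hQ => // I' hI' sub [x I'x nIx].
  apply: contrapT => nQ'; apply: h3; exists (I', x) => _; split=> //.
pose J := fix J n := if n is m.+1 then (nxt (J m)).1 else I.
have hJ n : is_ideal (J n) /\ ~ Q (J n).
  by elim: n => [|n IH] //; have [] := hnxt _ IH.
have subJ m n x : (m <= n)%N -> J m x -> J n x.
  move=> /subnK <-; elim: (n - m)%N => [|k IH] // hx.
  by rewrite addSn; have [_ h _ _] := hnxt _ (hJ (k + m)%N); apply/h/IH.
have [n hn] := hA (fun n => (nxt (J n)).2).
have [_ _ _] := hnxt _ (hJ n); apply; apply: hn; first by case: (hJ n).
move=> _ [i hi ->]; apply: (subJ i.+1) => //.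
by have [_ _] := hnxt _ (hJ i).
Qed.
End IdealGen.

(** A nonzero element of least absolute value in the ideal of all [a n] divides each of them, by
    Euclidean division. *)
Lemma noetherian_int : noetherian int.
Proof.
move=> a; pose I x := exists n, ideal_gen (before a n) x.
have hI : is_ideal I := ideal_union_before a.
have Ia n : I (a n).
  by exists n.+1; apply: mem_ideal_gen; exists n.
have [hex|hno] := pselect (exists n : nat,
    exists2 x, I x & x != 0 /\ `|x|%N = n); last first.
  exists 0%N; suff -> : a 0%N = 0 by case: (ideal_gen_ideal (before a 0)).
  by apply/eqP; apply: contrapT => /negP h; apply: hno; exists `|a 0%N|%N, (a 0%N).
have hexb : exists n : nat, `[< exists2 x, I x & x != 0 /\ `|x|%N = n >].
  by have [n h] := hex; exists n; apply/asboolP.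
case: (ex_minnP hexb) => m /asboolP [x [N hN] [x0 <-]] hmin.
exists N; rewrite (divz_eq (a N) x).
suff -> : (a N %% x)%Z = 0 by rewrite addr0; apply: idealM hN; exact: ideal_gen_ideal.
apply/eqP; apply: contrapT => /negP h.
have := hmin `|(a N %% x)%Z|%N.
rewrite -lez_nat !abszE [X in _ <= X]ger0_norm ?modz_ge0 //.
rewrite leNgt ltz_mod // => H; suff : false by [].
apply: H; apply/asboolP; exists (a N %% x)%Z; last by [].
rewrite /modz; apply: idealD => //; rewrite -mulNr; apply: idealM => //.
by exists N.
Qed.

Section Hilbert.
Variable A : comNzRingType.

Lemma noetherian_poly : noetherian A -> noetherian {poly A}.
Proof.
move=> hA f; apply: contrapT => hf.
have {}hf n : ~ ideal_gen (before f n) (f n) by move=> h; apply: hf; exists n.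
pose I x := exists n, ideal_gen (before f n) x.
have hI : is_ideal I := ideal_union_before f.
(* A set inside the ideal of the first [N] terms cannot generate [f N], so there is always an
   element of [I] left to choose. *)
pose fin (S : {poly A} -> Prop) := exists N, forall y, S y -> ideal_gen (before f N) y.
pose good S y := [/\ I y, ~ ideal_gen S y &
  forall z, I z -> ~ ideal_gen S z -> (size y <= size z)%N].
have [S|nxt hnxt] := @choice _ _ (fun S y => fin S -> good S y).
  have [[N hN]|h] := pselect (fin S); last by exists 0.
  have hexb : exists n : nat, `[< exists y, [/\ I y, ~ ideal_gen S y & size y = n] >].
    exists (size (f N)); apply/asboolP; exists (f N); split=> //.
      by exists N.+1; apply: mem_ideal_gen; exists N.
    by move=> h; apply: (hf N); apply: ideal_gen_sub h.
  case: (ex_minnP hexb) => m /asboolP [y [h1 h2 <-]] hmin.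
  exists y => _; split=> // z h3 h4; apply: hmin; apply/asboolP.
  by exists z.
pose st := fix st n :=
  if n is m.+1 then (fun y => st m y \/ y = nxt (st m)) else (fun=> False).
pose g n := nxt (st n).
have finst n : fin (st n).
  elim: n => [|n [N hN]]; first by exists 0%N.
  have [[M hM] _ _] := hnxt _ (ex_intro _ N hN).
  exists (maxn N M) => y [/hN hy|->].
    by apply: ideal_gen_before hy; exact: leq_maxl.
  by apply: ideal_gen_before hM; exact: leq_maxr.
have stP n y : before g n y -> st n y.
  move=> [i hi ->]; elim: n hi => // n IH; rewrite ltnS leq_eqVlt => /orP [/eqP ->|/IH].
    by right.
  by left.
have [n hn] := hA (fun n => lead_coef (g n)).
have [Ig nG ming] := hnxt _ (finst n).
have sizeg i : (i < n)%N -> (size (g i) <= size (g n))%N.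
  move=> hi; have [_ _ mini] := hnxt _ (finst i); apply: mini => // h; apply: nG.
  apply: ideal_gen_sub h => y hy; apply: mem_ideal_gen.
  have [k ->] : exists k, n = (k + i)%N by exists (n - i)%N; rewrite subnK // ltnW.
  by elim: k => [|k IH] //; rewrite addSn; left.
(* Multiplying by powers of 'X puts the earlier leading coefficients in [H], hence also that of
   [g n]. The resulting [y] cancels the leading term of [g n], against the minimality of its
   size. *)
pose H c := exists y : {poly A}, [/\ ideal_gen (st n) y, (size y <= size (g n))%N &
  y`_(size (g n)).-1 = c].
have hH : is_ideal H.
  split=> [|c x y [p [h1 h2 <-]] [q [h3 h4 <-]]].
    exists 0; rewrite size_poly0 coef0; split=> //.
    by case: (ideal_gen_ideal (st n)).
  exists (c%:P * p + q); split.
  - by apply: (ideal_gen_ideal _).2.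
  - apply: leq_trans (size_polyD _ _) _; rewrite geq_max h4 andbT.
    by rewrite mul_polyC; apply: leq_trans (size_scale_leq _ _) h2.
  - by rewrite coefD coefCM.
have [_ [i hi ->]|y [h1 h2 h3]] := hn H hH.
  exists ('X^(size (g n) - size (g i)) * g i); split.
  - by apply: (idealM _ (ideal_gen_ideal _)); apply: mem_ideal_gen; apply: stP; exists i.
  - rewrite mulrC; apply: leq_trans (size_polyMleq _ _) _.
    by rewrite size_polyXn addnS /= subnKC // sizeg.
  - have [->|gi0] := eqVneq (g i) 0; first by rewrite mulr0 lead_coef0 coef0.
    have si : (0 < size (g i))%N by rewrite size_poly_gt0.
    have sn := leq_trans si (sizeg _ hi).
    rewrite mulrC coefMXn.
    have -> : (size (g n)).-1 = ((size (g i)).-1 + (size (g n) - size (g i)))%N.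
      by rewrite -[in LHS](subnK (sizeg _ hi)) addnC -(prednK si).
    by rewrite ltnNge leq_addl addnK.
have gn0 : g n != 0.
  apply/eqP => h; apply: nG; rewrite -/(g n) h.
  by case: (ideal_gen_ideal (st n)).
have : (size (g n) <= size (g n - y)%R)%N.
  apply: ming.
    apply: idealD => //; apply: idealN => //.
    have [N hN] := finst n; exists N; apply: ideal_gen_sub h1 => z; exact: hN.
  move=> h; apply: nG; rewrite -/(g n) -[g n](subrK y).
  exact: (idealD (ideal_gen_ideal _) h h1).
have sn : (0 < size (g n))%N by rewrite size_poly_gt0.
rewrite -{1}(prednK sn) ltnNge => /negP; apply; apply/leq_sizeP => j hj.
rewrite coefB; move: hj; rewrite leq_eqVlt => /orP [/eqP <-|hj].
  by rewrite h3 subrr.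
rewrite prednK // in hj; rewrite !nth_default ?subr0 //.
exact: leq_trans hj.
Qed.
End Hilbert.

Lemma noetherian_cover (R : comNzRingType) (cs : seq R) :
  exists (A : comNzRingType) (t : {rmorphism A -> R}),
    noetherian A /\ forall c, c \in cs -> exists a, t a = c.
Proof.
elim: cs => [|c cs [A [t [hA ht]]]].
  by exists (int : comNzRingType), intr; split=> //; exact: noetherian_int.
pose t' : {rmorphism {poly A} -> R} := horner_morph (fun a => mulrC c (t a)).
exists ({poly A} : comNzRingType), t'; split; first exact: noetherian_poly.
move=> x; rewrite inE => /orP [/eqP ->|/ht [a <-]].
  by exists 'X; rewrite /t' /= horner_morphX.
by exists a%:P; rewrite /t' /= horner_morphC.
Qed.

(** The condition says that (I : r) is prime. If x and y refute this, (I : r y) contains (I : r) and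
    also x, so the induction runs on these ideals. *)
Lemma associated_prime (A : comPzRingType) (I : A -> Prop) :
  noetherian A -> is_ideal I -> ~ I 1 ->
  exists r, ~ I r /\ forall x y, I (r * x * y) -> I (r * x) \/ I (r * y).
Proof.
move=> hA hI I1.
suff h : forall p, is_ideal p -> forall r, ~ I r -> (forall x, p x <-> I (r * x)) ->
    exists r, ~ I r /\ forall x y, I (r * x * y) -> I (r * x) \/ I (r * y).
  by apply: (h I hI 1 I1) => x; rewrite mul1r.
apply: noetherian_ind => // p hp IH r Ir pE.
have [h|] := pselect (forall x y, I (r * x * y) -> I (r * x) \/ I (r * y)).
  by exists r.
move=> /existsNP [x /existsNP [y /not_implyP [h1 /not_orP [h2 h3]]]].
pose q z := I (r * y * z).
apply: (IH q _ _ _ (r * y) h3) => //.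
- split=> [|a z z' hz hz']; first by rewrite /q mulr0; case: hI.
  by rewrite /q mulrDr mulrCA; exact: hI.2.
- by move=> z /pE hz; rewrite /q mulrAC mulrC; exact: idealM.
- by exists x; [rewrite /q mulrAC | move=> /pE].
Qed.

(** * Groebner bases modulo a prime *)

Section Dickson.

Lemma monotone_subsequence (f : nat -> nat) :
  exists phi : nat -> nat, (forall k, (phi k < phi k.+1)%N) /\
    (forall k, (f (phi k) <= f (phi k.+1))%N).
Proof.
have [k|am ham] := @choice _ _ (fun k j =>
    (k <= j)%N /\ forall i, (k <= i)%N -> (f j <= f i)%N).
  have hex : exists v, `[< exists2 j, (k <= j)%N & f j = v >].
    by exists (f k); apply/asboolP; exists k.
  case: (ex_minnP hex) => v /asboolP [j kj <-] hmin; exists j; split=> // i ki.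
  by apply: hmin; apply/asboolP; exists i.
pose phi := fix phi k := if k is l.+1 then am (phi l).+1 else am 0%N.
exists phi; split=> k; first by case: (ham (phi k).+1).
(* [phi k] is where [f] attains its minimum from some [j] on, and [phi k.+1] lies beyond that
   [j]. *)
have h : exists j, phi k = am j /\ (j <= phi k)%N.
  case: k => [|k] /=; first by exists 0%N.
  by exists (phi k).+1; split=> //; exact: (ham (phi k).+1).1.
have [j [E hj]] := h; rewrite {1}E; apply: (ham j).2.
apply: leq_trans hj (leq_trans (leqnSn _) _); exact: (ham (phi k).+1).1.
Qed.

Lemma increasing_mono (T : Type) (r : T -> T -> Prop) (g : nat -> T) :
  (forall x, r x x) -> (forall y x z, r x y -> r y z -> r x z) ->
  (forall k, r (g k) (g k.+1)) -> forall i j, (i <= j)%N -> r (g i) (g j).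
Proof.
move=> r0 rt h i j /subnK <-; elim: (j - i)%N => [|k IH] //.
by apply: rt IH _; rewrite addSn.
Qed.

Lemma monotone_subsequences (T : Type) (d : nat) (f : nat -> T -> nat) (x : nat -> T) :
  exists phi : nat -> nat, (forall k, (phi k < phi k.+1)%N) /\
    (forall i k, (i < d)%N -> (f i (x (phi k)) <= f i (x (phi k.+1)))%N).
Proof.
elim: d => [|d [phi [h1 h2]]]; first by exists id.
have [psi [h3 h4]] := monotone_subsequence (fun k => f d (x (phi k))).
exists (phi \o psi); split=> [k|i k] /=.
  have := @increasing_mono nat leq phi leqnn leq_trans (fun k => ltnW (h1 k)).
  by move=> h; apply: leq_trans (h1 _) (h _ _ (h3 k)).
rewrite ltnS leq_eqVlt => /orP [/eqP ->|hi]; first exact: h4.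
apply: (@increasing_mono nat leq (fun k => f i (x (phi k))) leqnn leq_trans).
  by move=> l; exact: h2.
exact: ltnW.
Qed.

(** Otherwise dependent choice gives a sequence in which no term lies below a later one for all [d]
    functions, contradicting a subsequence monotone for all of them. *)
Lemma dickson (T : eqType) (d : nat) (f : nat -> T -> nat) (M : T -> Prop) :
  exists l : seq T, (forall x, x \in l -> M x) /\
    forall b, M b -> exists2 x, x \in l & forall i, (i < d)%N -> (f i x <= f i b)%N.
Proof.
apply: contrapT => hno.
have [b0 _] : exists b, M b.
  apply: contrapT => h; apply: hno; exists [::]; split=> // b Mb.
  by case: h; exists b.
have [l|nxt hn] := @choice _ _ (fun (l : seq T) b => (forall x, x \in l -> M x) ->
   M b /\ forall x, x \in l -> exists2 i, (i < d)%N & ~ (f i x <= f i b)%N).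
  have [hl|] := pselect (forall x, x \in l -> M x); last by exists b0.
  apply: contrapT => h; apply: hno; exists l; split=> // b Mb.
  apply: contrapT => h2; apply: h; exists b => _; split=> // x xl.
  apply: contrapT => h3; apply: h2; exists x => // i hi.
  by apply: contrapT => h4; apply: h3; exists i.
pose h := fix h n := if n is m.+1 then nxt (h m) :: h m else [::].
have hM n x : x \in h n -> M x.
  elim: n x => // n IH x /=; rewrite inE => /orP [/eqP ->|/IH //].
  by case: (hn _ IH).
have mem_h i j : (i < j)%N -> nxt (h i) \in h j.
  elim: j => // j IH; rewrite ltnS leq_eqVlt /= inE => /orP [/eqP ->|/IH ->].
    by rewrite eqxx.
  by rewrite orbT.
have [phi [h1 h2]] := monotone_subsequences d f (fun n => nxt (h n)).
have [_ /(_ _ (mem_h _ _ (h1 0%N))) [i hi]] := hn _ (hM (phi 1%N)).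
by apply; exact: h2.
Qed.
End Dickson.

Local Notation fmod R n m := {ffun 'I_n -> {mpoly R[m]}}.
Local Notation fidx n m := ('I_n * 'X_{1..m})%type.

Section FreeModule.
Variables (R : comNzRingType) (n m : nat).

Definition fmod_basis : basis (fmod R n m : lmodType R) (fidx n m : choiceType).
Proof.
apply: (@Basis _ _ _
  (fun b : fidx n m => [ffun j => (j == b.1)%:R *: 'X_[b.2]] : fmod R n m)
  (fun v b => (v b.1)@_(b.2))
  (fun v => [seq (i, a) | i <- enum 'I_n, a <- msupp (v i)])).
- move=> v; apply: allpairs_uniq_dep.
  + exact: enum_uniq.
  + by move=> i _; exact: msupp_uniq.
  + by move=> [i a] [j b] _ _ /= [-> ->].
- move=> v [i a] /= h; apply: memN_msupp_eq0; apply: contraNN h => h.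
  by apply/allpairsPdep; exists i, a; rewrite mem_enum.
- by move=> b a x y; rewrite !ffunE mcoeffD mcoeffZ.
- move=> [i a] [j b]; rewrite ffunE mcoeffZ mcoeffX /= -natrM mulnb.
  by congr (_%:R); rewrite xpair_eqE eq_sym.
- move=> v; apply/ffunP => j; rewrite big_allpairs_dep sum_ffunE.
  rewrite big_enum /= (bigD1 j) //= [X in _ + X]big1 ?addr0; last first.
    move=> i hi; rewrite sum_ffunE big1 // => a _.
    by rewrite !ffunE eq_sym (negPf hi) scale0r scaler0.
  rewrite sum_ffunE {1}[v j]mpolyE.
  apply: eq_bigr => a _.
  by rewrite !ffunE eqxx scale1r.
Defined.

Definition fmod_shift (g : 'X_{1..m}) (v : fmod R n m) : fmod R n m :=
  [ffun i => v i * 'X_[g]].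

Lemma coord_shift g v i a :
  coord fmod_basis (fmod_shift g v) (i, (g + a)%MM) = coord fmod_basis v (i, a).
Proof. by rewrite /= ffunE mcoeffMX. Qed.

Lemma coord_shift_neq0 g v b : coord fmod_basis (fmod_shift g v) b != 0 ->
  exists a, b = (b.1, (g + a)%MM).
Proof.
case: b => i b; rewrite /= ffunE -mcoeff_msupp (perm_mem (msuppMX _ _)).
by move=> /mapP [a _ ->]; exists a.
Qed.
End FreeModule.

Section MonomialOrder.
Variables n m : nat.
Implicit Types b c d : fidx n m.

(** Positions only break ties between equal monomials, so shifts by a monomial preserve the
    order. *)
Definition fidx_lt : rel (fidx n m) := fun b c =>
  (b.2 < c.2)%O || (b.2 == c.2) && (b.1 < c.1)%N.

Lemma fidx_lt_wf : well_founded fidx_lt.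
Proof.
suff h a : forall i, Acc fidx_lt (i, a) by case=> i a.
elim/(well_founded_ind (@ltom_wf m)): a => a IHa i.
move: {2}(nat_of_ord i) (leqnn i) => k.
elim: k i => [|k IHk] i hi; constructor=> -[j c]; rewrite /fidx_lt /=.
  case/orP => [/IHa //|/andP [_ h]].
  by have := leq_trans h hi.
case/orP => [/IHa //|/andP [/eqP -> h]]; apply: IHk.
by rewrite -ltnS (leq_trans h).
Qed.

Lemma fidx_lt_total b c : b != c -> fidx_lt b c || fidx_lt c b.
Proof.
case: b c => [i a] [j d]; rewrite xpair_eqE /fidx_lt /=.
case: (ltgtP a d) => //= _; rewrite andbT -(inj_eq val_inj) /= => h.
by rewrite -neq_ltn.
Qed.

Lemma fidx_lt_trans : transitive fidx_lt.
Proof.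
move=> [j c] [i a] [k d]; rewrite /fidx_lt /=.
case/orP => [h1|/andP [/eqP -> h1]] /orP [h2|/andP [/eqP <- h2]].
- by rewrite (lt_trans h1 h2).
- by rewrite h1.
- by rewrite h2.
- by rewrite eqxx (ltn_trans h1 h2) orbT.
Qed.

Lemma fidx_lt_shift g b c :
  fidx_lt b c -> fidx_lt (b.1, (g + b.2)%MM) (c.1, (g + c.2)%MM).
Proof. by rewrite /fidx_lt /= ltmc_add2r eqm_add2l. Qed.

Lemma fidx_max (s : seq (fidx n m)) (Q : fidx n m -> Prop) :
  (exists2 b, b \in s & Q b) ->
  exists b, Q b /\ forall c, c \in s -> Q c -> c = b \/ fidx_lt c b.
Proof.
elim: s => [[b] //|x s IH].
have [h|h] := pselect (exists2 b, b \in s & Q b); last first.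
  move=> [b]; rewrite inE => /orP [/eqP -> Qx|bs Qb]; last by case: h; exists b.
  exists x; split=> // c; rewrite inE => /orP [/eqP|cs Qc]; first by left.
  by case: h; exists c.
move=> _; have [c [Qc hc]] := IH h.
have [[Qx ltcx]|hx] := pselect (Q x /\ fidx_lt c x).
  exists x; split=> // d; rewrite inE => /orP [/eqP|ds Qd]; first by left.
  right; have [->//|ltdc] := hc d ds Qd; exact: fidx_lt_trans ltdc ltcx.
exists c; split=> // d; rewrite inE => /orP [/eqP -> Qx|]; last exact: hc.
have [->|ncx] := eqVneq x c; [by left | right].
by case/orP: (fidx_lt_total ncx) => // ltcx; case: hx.
Qed.
End MonomialOrder.

Section Groebner.
Variables (A : comNzRingType) (n m : nat).
Variables (N : fmod A n m -> Prop) (p : A -> Prop).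
Hypotheses (hN : submodule N) (hNX : forall g v, N v -> N (fmod_shift g v)).
Hypotheses (hp : is_ideal p) (p1 : ~ p 1) (pM : forall x y, p (x * y) -> p x \/ p y).

Local Notation co := (coord (fmod_basis A n m)).

Definition leads (v : fmod A n m) b : Prop :=
  ~ p (co v b) /\ forall c, c != b -> ~ p (co v c) -> fidx_lt c b.

Lemma leads_exists v : (forall b, p (co v b)) \/ exists b, leads v b.
Proof.
have [h|/existsNP [b hb]] := pselect (forall b, p (co v b)); first by left.
right; have hs c : ~ p (co v c) -> c \in bsupp (fmod_basis A n m) v.
  move=> h; apply: contraT => /(coord_notin (b0 := fmod_basis A n m)) h0.
  by case: h; rewrite h0; case: hp.
have [|c [h1 h2]] := @fidx_max n m (bsupp (fmod_basis A n m) v)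
    (fun c => ~ p (co v c)).
  by exists b; [exact: hs|].
exists c; split=> // d hd h3; have [h|//] := h2 d (hs _ h3) h3.
by rewrite h eqxx in hd.
Qed.

(** By Dickson's lemma, finitely many [g x] have leading terms dividing all others. With [s] the
    product of their leading coefficients, a shift of [g x] times the remaining factors has
    coefficient exactly [s]; primality keeps [s] outside [p]. A common [s] leaves a single element
    to invert. *)
Lemma groebner : exists s, ~ p s /\ forall b, (exists2 v, N v & leads v b) ->
  exists k, [/\ N k, co k b = s &
    forall c, c != b -> ~ p (co k c) -> fidx_lt c b].
Proof.
(* Comparing both [b.1] and [n - b.1] forces equal indices in ['I_n]. *)
pose f i (b : fidx n m) : nat :=
  if i == 0%N then nat_of_ord b.1 else if i == 1%N then (n - b.1)%N
  else nth 0%N b.2 i.-2.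
have [l [h1 h2]] := @dickson (fidx n m) m.+2 f (fun b => exists2 v, N v & leads v b).
have [b|g hg] := @choice _ _ (fun b v => b \in l -> N v /\ leads v b).
  have [/h1 [v Nv hv]|hb] := boolP (b \in l); last by exists 0.
  by exists v.
pose s := \prod_(b <- l) co (g b) b.
exists s; split.
  have : forall b, b \in l -> ~ p (co (g b) b) by move=> b /hg [_ []].
  rewrite /s; elim: (l) => [|b l' IH] h; first by rewrite big_nil.
  rewrite big_cons => /pM [|]; first by apply: h; rewrite mem_head.
  by apply: IH => c hc; apply: h; rewrite inE hc orbT.
move=> b hb; have [x xl hx] := h2 b hb.
have [Nx [lx1 lx2]] := hg _ xl.
have ex1 : x.1 = b.1.
  apply: val_inj; apply/eqP; rewrite eqn_leq (hx 0%N) //=.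
  have := hx 1%N isT; rewrite /f /= => h.
  by have := leq_sub2l n h; rewrite !subKn // ltnW.
have lex : (x.2 <= b.2)%MM.
  apply/mnm_lepP => i; have := hx i.+2; rewrite /f /= !ltnS => /(_ (ltn_ord i)).
  by rewrite -!mnm_nth.
pose e := (b.2 - x.2)%MM.
have eb : (e + x.2)%MM = b.2 by rewrite submK.
have [c hc] : exists c, s = c * co (g x) x.
  by exists (\prod_(y <- rem x l) co (g y) y); rewrite mulrC /s (big_rem x xl).
exists (c *: fmod_shift e (g x)); split.
- by apply: submoduleZ => //; apply: hNX.
- rewrite coordZ [b]surjective_pairing -eb -ex1 coord_shift hc.
  by rewrite -surjective_pairing.
- move=> d hd; rewrite coordZ => hpd.
  have {}hpd : ~ p (co (fmod_shift e (g x)) d) by move=> h; apply: hpd; apply: idealM.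
  have : co (fmod_shift e (g x)) d != 0.
    by apply/eqP => h; apply: hpd; rewrite h; case: hp.
  move=> /coord_shift_neq0 [a ha].
  rewrite ha [b]surjective_pairing -eb -ex1; apply: (@fidx_lt_shift n m e (d.1, a) x).
  apply: lx2.
    by apply: contraNN hd => /eqP h; rewrite ha [b]surjective_pairing -eb -ex1 -h.
  by move=> h; apply: hpd; rewrite ha coord_shift.
Qed.
End Groebner.

(** * Iterated and multivariate polynomials *)

Section UnivariateIso.
Variables (R : comNzRingType) (m : nat).

Local Notation restr a := [multinom (a (widen_ord (leqnSn m) i)) | i < m].

Let coef_muni (p : {mpoly R[m.+1]}) (a : 'X_{1..m.+1}) :
  ((muni p)`_(a ord_max))@_(restr a) = p@_a.
Proof.
rewrite muniE coef_sum raddf_sum /= [in RHS](mpolyE p) raddf_sum /=.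
apply: eq_bigr => b _; rewrite coefZ coefXn mulr_natr mcoeffMn !mcoeffZ !mcoeffX.
rewrite -mulrnAr -mulrnA mulnb; congr (_ * _%:R).
congr nat_of_bool.
apply/andP/eqP => [[/eqP /mnmP h1 /eqP h2]|->]; last by rewrite !eqxx.
apply/mnmP => i; have [j ->|->] := unliftP ord_max i; last by [].
have -> : lift ord_max j = widen_ord (leqnSn m) j by apply: val_inj; exact: lift_max.
by have := h1 j; rewrite !mnmE.
Qed.

Lemma muni_bij : bijective (@muni m R).
Proof.
have inj : injective (@muni m R).
  by move=> p q h; apply/mpolyP => a; rewrite -!coef_muni h.
pose ext (a : 'X_{1..m}) k : 'X_{1..m.+1} :=
  [multinom oapp a k (unlift ord_max i) | i < m.+1].
have muniX a k : muni 'X_[ext a k] = 'X_[a] *: 'X^k :> {poly {mpoly R[m]}}.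
  rewrite muniE msuppX big_seq1 mcoeffX eqxx scale1r mnmE unlift_none /=.
  congr ('X_[_] *: _); apply/mnmP => i; rewrite !mnmE.
  have -> : widen_ord (leqnSn m) i = lift ord_max i.
    by apply: val_inj; apply: esym; exact: lift_max.
  by rewrite liftK.
have surj q : exists p, muni p = q :> {poly {mpoly R[m]}}.
  exists (\sum_(k < size q) \sum_(a <- msupp q`_k) q`_k@_a *: 'X_[ext a k]).
  rewrite raddf_sum -[RHS]coefK poly_def; apply: eq_bigr => k _.
  rewrite raddf_sum [in RHS](mpolyE q`_k) scaler_suml; apply: eq_bigr => a _.
  by rewrite /= muniZ muniX scalerA mul_mpolyC.
have [g hg] := choice surj; exists g => // p; exact/inj/hg.
Qed.
End UnivariateIso.

Fixpoint mconst (R : comNzRingType) (m : nat) : R -> Defs.mpoly R m :=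
  match m return R -> Defs.mpoly R m with
  | 0 => fun c => c
  | m'.+1 => fun c => (mconst m' c)%:P : {poly Defs.mpoly R m'}
  end.

Lemma mpoly_iso (R : comNzRingType) (m : nat) :
  exists chi : {rmorphism {mpoly R[m]} -> Defs.mpoly R m},
    bijective chi /\ forall c, chi c%:MP = mconst m c.
Proof.
elim: m => [|m [chi [bchi hchi]]].
  exists (mcoeff 0%MM : {rmorphism {mpoly R[0]} -> R}); split.
    by exists (@mpolyC 0 R); [exact: mpolyKC | exact: mpolyCK].
  by move=> c; rewrite /= mpolyCK.
exists (map_poly chi \o @muni m R :
  {rmorphism {mpoly R[m.+1]} -> {poly Defs.mpoly R m}}).
split; last by move=> c /=; rewrite muniC map_polyC /= hchi.
apply: bij_comp (muni_bij R m).
have [g h1 h2] := bchi.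
have g0 : g 0 = 0 by rewrite -(rmorph0 chi) h1.
exists (map_poly g).
  by apply: map_polyK.
by apply: map_polyK => //; rewrite rmorph0.
Qed.

Lemma meval_rmorphism (R : comNzRingType) (S : comPzRingType)
    (phi : {rmorphism R -> S}) (s : nat -> S) m :
  exists e : {rmorphism Defs.mpoly R m -> S},
    e =1 @Defs.meval R S phi s m /\ forall c, e (mconst m c) = phi c.
Proof.
elim: m => [|m [e [he hc]]]; first by exists phi.
pose t := s m.
pose E (p : {poly Defs.mpoly R m}) := \sum_(i < size p) e p`_i * t ^+ i.
have Ele (p : {poly Defs.mpoly R m}) k : (size p <= k)%N ->
    E p = \sum_(i < k) e p`_i * t ^+ i.
  move=> h; rewrite /E (big_ord_widen _ (fun i => e p`_i * t ^+ i) h) big_mkcond.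
  apply: eq_bigr => i _; case: ltnP => // hi.
  by rewrite nth_default // rmorph0 mul0r.
have ED (p q : {poly Defs.mpoly R m}) : E (p + q) = E p + E q.
  pose k := maxn (size p) (size q).
  rewrite !(@Ele _ k) ?leq_maxl ?leq_maxr ?size_polyD // -big_split.
  by apply: eq_bigr => i _; rewrite coefD rmorphD mulrDl.
have E0 : E 0 = 0 by rewrite /E size_poly0 big_ord0.
have EX (p : {poly Defs.mpoly R m}) : E (p * 'X) = E p * t.
  rewrite (@Ele _ (size p).+1); last first.
    by apply: leq_trans (size_polyMleq _ _) _; rewrite size_polyX addn2.
  rewrite big_ord_recl coefMX /= rmorph0 mul0r add0r mulr_suml.
  by apply: eq_bigr => i _; rewrite coefMX /= exprSr mulrA.
have EC c (p : {poly Defs.mpoly R m}) : E (c%:P * p) = e c * E p.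
  rewrite (@Ele _ (size p)); last by rewrite mul_polyC size_scale_leq.
  rewrite mulr_sumr; apply: eq_bigr => i _.
  by rewrite coefCM rmorphM mulrA.
have E1 : E 1 = 1.
  by rewrite /E size_poly1 big_ord1 coef1 eqxx rmorph1 mulr1.
have EM (p q : {poly Defs.mpoly R m}) : E (p * q) = E p * E q.
  elim/poly_ind: p => [|p c IH]; first by rewrite !mul0r E0 mul0r.
  rewrite mulrDl ED EC mulrAC EX IH ED EX mulrDl mulrAC; congr (_ + _).
  by rewrite -[c%:P]mulr1 EC E1 mulr1.
have EB : {morph E : p q / p - q}.
  move=> p q; apply/eqP; rewrite eq_sym subr_eq -ED subrK eqxx //.
pose aE := GRing.isZmodMorphism.Build _ _ E EB.
pose mE := GRing.isMonoidMorphism.Build _ _ E (E1, EM).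
pose Er : {rmorphism {poly Defs.mpoly R m} -> S} := HB.pack E aE mE.
exists Er; split=> [p|c] /=.
  by apply: eq_bigr => i _; rewrite he.
by rewrite -[(mconst m c)%:P]mulr1 EC E1 mulr1 hc.
Qed.

Lemma algebra_presentation (R : comNzRingType) (S : comPzRingType)
    (phi : {rmorphism R -> S}) : fin_pres_algebra phi ->
  exists m k (g : 'I_k -> {mpoly R[m]}) (ev : {rmorphism {mpoly R[m]} -> S}),
    [/\ forall c, ev c%:MP = phi c, forall x, exists p, ev p = x,
        forall j, ev (g j) = 0 &
        forall p, ev p = 0 -> exists q : 'I_k -> {mpoly R[m]},
          p = \sum_(j < k) q j * g j].
Proof.
move=> [m [s [k [g [h1 h2]]]]].
have [chi [[chi' chiK chi'K] chiC]] := mpoly_iso R m.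
have [e [he eC]] := meval_rmorphism phi s m.
pose ev : {rmorphism {mpoly R[m]} -> S} := e \o chi.
exists m, k, (fun j => chi' (g j)), ev; split.
- by move=> c; rewrite /ev /= chiC.
- by move=> x; have [p hp] := h1 x; exists (chi' p); rewrite /ev /= chi'K he.
- move=> j; rewrite /ev /= chi'K he; apply/h2; exists (fun i => (i == j)%:R).
  rewrite (bigD1 j) //= eqxx mul1r big1 ?addr0 // => i /negPf ->.
  by rewrite mul0r.
- move=> p; rewrite /ev /= he => /h2 [q hq]; exists (chi' \o q).
  apply: (can_inj chiK); rewrite hq rmorph_sum; apply: eq_bigr => j _.
  by rewrite rmorphM /= !chi'K.
Qed.

Lemma module_presentation (R : comNzRingType) (S : comPzRingType)
    (phi : {rmorphism R -> S}) (F : lmodType S) :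
  fin_pres_algebra phi -> fin_pres_module F ->
  exists n m (J : finType) (gen : J -> fmod R n m)
    (pr : {linear fmod R n m -> resmod phi F}),
    [/\ forall x, exists v, pr v = x,
        forall u (v : fmod R n m), pr v = 0 -> pr [ffun i => u * v i] = 0,
        forall j, pr (gen j) = 0 &
        forall v, pr v = 0 -> exists u : J -> {mpoly R[m]},
          v = \sum_j [ffun i => u j * gen j i]].
Proof.
move=> /algebra_presentation [m [k [g [ev [evC evs evg evK]]]]].
move=> [n [l [f [A [fs frel]]]]].
have [|pr prE] := @linear_exists R (fmod R n m) (resmod phi F)
    (fun v => \sum_(i < n) ev (v i) *: f i).
  move=> a x y.
  transitivity (phi a *: (\sum_(i < n) ev (x i) *: f i) +
    \sum_(i < n) ev (y i) *: f i) => //.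
  rewrite scaler_sumr -big_split; apply: eq_bigr => i _.
  by rewrite !ffunE rmorphD -mul_mpolyC rmorphM evC scalerDl scalerA.
have [r hr] := choice (fun b : 'I_l * 'I_n => evs (A b.1 b.2)).
(* The relations of [F] over [S], lifted to polynomials, together with the relations of [S] placed
   in each of the [n] positions. *)
pose gen (j : 'I_l + 'I_n * 'I_k) : fmod R n m :=
  match j with
  | inl a => [ffun i => r (a, i)]
  | inr b => [ffun i => if i == b.1 then g b.2 else 0]
  end.
exists n, m, ('I_l + 'I_n * 'I_k)%type, gen, pr; split.
- move=> x; have [v <-] := fs x.
  have [w hw] := choice (fun i => evs (v 0 i)).
  by exists [ffun i => w i]; rewrite prE; apply: eq_bigr => i _; rewrite ffunE hw.
- move=> u v; rewrite !prE => h.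
  have h' : \sum_(i < n) ev (v i) *: f i = 0 := h.
  transitivity (ev u *: (\sum_(i < n) ev (v i) *: f i)); last by rewrite h' scaler0.
  rewrite scaler_sumr; apply: eq_bigr => i _.
  by rewrite ffunE rmorphM scalerA.
- case=> [a|[i j]]; rewrite prE /=.
    transitivity (\sum_(i < n) (row a A) 0 i *: f i).
      by apply: eq_bigr => i _; rewrite ffunE hr mxE.
    by apply/frel; exists (delta_mx 0 a); rewrite rowE.
  apply: big1 => i' _; rewrite ffunE; case: ifP => _.
    by rewrite evg scale0r.
  by rewrite rmorph0 scale0r.
- move=> v; rewrite prE => h.
  have [|u hu] := (frel (\row_i ev (v i))).1.
    by rewrite -[RHS]h; apply: eq_bigr => i _; rewrite mxE.
  have [w hw] := choice (fun a => evs (u 0 a)).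
  have hev i : ev (v i - \sum_(a < l) w a * r (a, i)) = 0.
    rewrite rmorphB rmorph_sum; apply/eqP; rewrite subr_eq0; apply/eqP.
    have := congr1 (fun M : 'rV_n => M 0 i) hu; rewrite !mxE => ->.
    by apply: eq_bigr => a _; rewrite rmorphM hw hr.
  have [q hq] := choice (fun i => evK _ (hev i)).
  exists (fun j => match j with inl a => w a | inr b => q b.1 b.2 end).
  apply/ffunP => i; rewrite sum_ffunE big_sumType /=.
  rewrite -[LHS](subrK (\sum_(a < l) w a * r (a, i))) [LHS]addrC; congr (_ + _).
    by apply: eq_bigr => a _; rewrite !ffunE.
  rewrite hq -(pair_bigA _ (fun x j => [ffun i0 => q x j * gen (inr (x, j)) i0] i)) /=.
  rewrite (bigD1 i) //= [X in _ + X]big1 ?addr0.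
    by apply: eq_bigr => j _; rewrite !ffunE eqxx.
  by move=> x /negPf hx; apply: big1 => j _; rewrite !ffunE eq_sym hx mulr0.
Qed.

(** * Noetherian induction *)

(** Division with remainder modulo p = (I : r): s v minus a multiple of [k b] loses the leading
    term, and multiplication by r moves coefficients from [p] into [I]. Each round costs a factor r
    s, which the last closure property of [H] removes. *)
Lemma leading_reduction (A : comNzRingType) n m (N H : fmod A n m -> Prop)
    (I : A -> Prop) (r s : A) (k : fidx n m -> fmod A n m) :
  let p x := I (r * x) in let co := coord (fmod_basis A n m) in
  let M b := exists2 v, N v & leads p v b in
  is_ideal I -> submodule N -> submodule H ->
  (forall b, M b ->
    [/\ N (k b), co (k b) b = s &
        forall c, c != b -> ~ p (co (k b) c) -> fidx_lt c b]) ->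
  (forall v, N v -> (forall b, I (co v b)) -> H v) ->
  (forall b, M b -> H (r *: k b)) ->
  (forall v, N v -> H ((r * s) *: v) -> H v) ->
  forall v, N v -> H v.
Proof.
move=> p co M hI hN hH hk HI Hk Hr.
have hp : is_ideal p.
  split=> [|a x y hx hy]; first by rewrite /p mulr0; case: hI.
  by rewrite /p mulrDr mulrCA; exact: hI.2.
have Hp v : N v -> (forall b, p (co v b)) -> H v.
  move=> Nv hv; apply: Hr => //; rewrite mulrC -scalerA.
  apply: submoduleZ => //; apply: HI; first exact: submoduleZ.
  by move=> b; rewrite /co coordZ; exact: hv.
suff lead b : forall v, N v -> leads p v b -> H v.
  by move=> v Nv; have [/(Hp _ Nv)//|[b /lead]] := leads_exists hp v; apply.
elim/(well_founded_ind (@fidx_lt_wf n m)): b => b IH v Nv hv.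
have Mb : M b by exists v.
have [Nk ks kl] := hk b Mb; have Hkb := Hk b Mb.
pose w := s *: v - co v b *: k b.
have Nw : N w by apply: submoduleB => //; apply: submoduleZ.
have hw c : ~ p (co w c) -> fidx_lt c b.
  have [->|ncb] := eqVneq c b.
    case; rewrite /w /co coordB !coordZ -/co ks mulrC subrr.
    by case: hp.
  move=> h; have [/hv.2|h1] := pselect (~ p (co v c)); first exact.
  apply: (kl c ncb) => h2; apply: h.
  rewrite /w /co coordB !coordZ -/co.
  apply: idealD => //; last by apply: idealN => //; exact: idealM.
  by apply: idealM => //; exact: contrapT.
have Hw : H w.
  have [/(Hp _ Nw)//|[c hc]] := leads_exists hp w.
  by apply: (IH c) => //; apply: hw; case: hc.
apply: Hr => //; rewrite -scalerA.
have -> : s *: v = w + co v b *: k b by rewrite subrK.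
rewrite scalerDr; apply: submoduleD => //; first exact: submoduleZ.
by rewrite scalerA mulrC -scalerA; exact: submoduleZ.
Qed.

Section MapModule.
Variables (A R : comNzRingType) (t : {rmorphism A -> R}) (n m : nat).

Definition fmod_map (v : fmod A n m) : fmod R n m := [ffun i => map_mpoly t (v i)].

Lemma coord_map v b :
  coord (fmod_basis R n m) (fmod_map v) b = t (coord (fmod_basis A n m) v b).
Proof. by rewrite /= ffunE mcoeff_map_mpoly. Qed.

Lemma fmod_mapP a v w : fmod_map (a *: v + w) = t a *: fmod_map v + fmod_map w.
Proof. by apply/ffunP => i; rewrite !ffunE raddfD /= map_mpolyZ. Qed.

Lemma fmod_map_lift (v : fmod R n m) :
  (forall i a, a \in msupp (v i) -> exists c, t c = (v i)@_a) ->
  exists w, fmod_map w = v.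
Proof.
move=> h.
have [i|w hw] := @choice _ _ (fun i (q : {mpoly A[m]}) => map_mpoly t q = v i).
  have [a|c hc] := @choice _ _ (fun a c => a \in msupp (v i) -> t c = (v i)@_a).
    have [/h [c hc]|_] := boolP (a \in msupp (v i)); last by exists 0.
    by exists c.
  exists (\sum_(a <- msupp (v i)) c a *: 'X_[a]).
  rewrite raddf_sum [RHS]mpolyE !big_seq; apply: eq_bigr => a ha /=.
  by rewrite map_mpolyZ map_mpolyX hc.
by exists [ffun i => w i]; apply/ffunP => i; rewrite !ffunE.
Qed.
End MapModule.

Lemma extends_mod_sub (R : comPzRingType) (P : lmodType R) (K : P -> Prop) rs
    (J J' : R -> Prop) :
  (forall x, J x -> J' x) -> extends_mod K rs J -> extends_mod K rs J'.
Proof. by move=> h hQ C hrs hJ; apply: hQ => // a /h; exact: hJ. Qed.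

Section Descent.
Variables (A R : comNzRingType) (t : {rmorphism A -> R}) (n m : nat).
Variables (J : finType) (gen : J -> fmod A n m) (K : fmod R n m -> Prop).

Local Notation basisA := (fmod_basis A n m).
Local Notation basisR := (fmod_basis R n m).
Local Notation tm := (@fmod_map A R t n m).

Hypotheses (hA : noetherian A) (hK : submodule K) (hpure : pure basisR K).
Hypothesis KM : forall u v, K v -> K [ffun i => u * v i].
Hypothesis Kgen : forall j, K (tm (gen j)).
Hypothesis K_span : forall v, K v -> exists u : J -> {mpoly R[m]},
  v = \sum_j [ffun i => u j * tm (gen j) i].

Let N (v : fmod A n m) := exists u : J -> {mpoly A[m]},
  v = \sum_j [ffun i => u j * gen j i].

Let subN : submodule N.
Proof.
split=> [|a x y [u ->] [w ->]].
  exists (fun=> 0); rewrite big1 // => j _.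
  by apply/ffunP => i; rewrite !ffunE mul0r.
exists (fun j => a *: u j + w j); rewrite scaler_sumr -big_split.
by apply: eq_bigr => j _; apply/ffunP => i; rewrite !ffunE mulrDl scalerAl.
Qed.

Let NX g v : N v -> N (fmod_shift g v).
Proof.
move=> [u ->]; exists (fun j => u j * 'X_[g]); apply/ffunP => i.
rewrite ffunE !sum_ffunE mulr_suml; apply: eq_bigr => j _.
by rewrite !ffunE mulrAC.
Qed.

Let tmN v : N v -> K (tm v).
Proof.
move=> [u ->].
have -> : tm (\sum_j [ffun i => u j * gen j i]) =
    \sum_j [ffun i => map_mpoly t (u j) * tm (gen j) i].
  apply/ffunP => i; rewrite ffunE !sum_ffunE raddf_sum; apply: eq_bigr => j _.
  by rewrite !ffunE /= rmorphM.
by apply: submodule_sum => // j _; exact: KM.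
Qed.

Let Ngen g j : N (fmod_shift g (gen j)).
Proof.
apply: NX; exists (fun i => (i == j)%:R); rewrite (bigD1 j) //= big1 ?addr0.
  by apply/ffunP => i; rewrite ffunE eqxx mul1r.
by move=> i /negPf ->; apply/ffunP => l; rewrite !ffunE mul0r.
Qed.

(** Expanding the polynomial coefficients of a relation into monomials shows that [K] is the
    [R]-span of the image of [N]. *)
Let K_tmN (H : fmod R n m -> Prop) : submodule H ->
  (forall v, N v -> H (tm v)) -> forall v, K v -> H v.
Proof.
move=> hH h v /K_span [u ->]; apply: submodule_sum => // j _.
have -> : [ffun i => u j * tm (gen j) i] =
    \sum_(a <- msupp (u j)) (u j)@_a *: tm (fmod_shift a (gen j)).
  apply/ffunP => i; rewrite ffunE sum_ffunE {1}(mpolyE (u j)) mulr_suml.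
  apply: eq_bigr => a _.
  by rewrite !ffunE rmorphM /= map_mpolyX -scalerAl mulrC.
apply: submodule_sum => // a _; apply: submoduleZ => //; exact/h/Ngen.
Qed.

Let ext (I : A -> Prop) := ideal_gen (fun y => exists2 x, I x & y = t x).

Lemma extends_noetherian (I : A -> Prop) : is_ideal I ->
  exists rs, extends_mod K rs (ext I).
Proof.
move: I; apply: noetherian_ind => // I hI IH.
have hJ : is_ideal (ext I) by exact: ideal_gen_ideal.
have [I1|I1] := pselect (I 1).
  exists [::] => C _ hC u hu.
  have C0 (c : C) : c = 0.
    rewrite -[c]scale1r; apply: hC; apply: mem_ideal_gen.
    by exists 1; rewrite ?rmorph1.
  have [w _] := basis_ext basisR (fun=> 0 : C); exists w => k _.
  by rewrite (C0 (w k)) (C0 (u k)).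
have [r [Ir prime_r]] := associated_prime hA hI I1.
pose p x := I (r * x).
have hp : is_ideal p.
  split=> [|a x y hx hy]; first by rewrite /p mulr0; case: hI.
  by rewrite /p mulrDr mulrCA; exact: hI.2.
have p1 : ~ p 1 by rewrite /p mulr1.
have pM x y : p (x * y) -> p x \/ p y by rewrite /p mulrA; exact: prime_r.
have [s [ps hs]] := groebner subN NX hp p1 pM.
pose M b := exists2 v, N v & leads p v b.
have [b|k hk] := @choice _ _ (fun b k => M b ->
    [/\ N k, coord basisA k b = s &
        forall c, c != b -> ~ p (coord basisA k c) -> fidx_lt c b]).
  by have [/hs [k hk]|hb] := pselect (M b); [exists k | exists 0].
have [|||rs hrs] := IH (add_principal I (r * s)).
- exact: ideal_add_principal.
- by move=> x hx; exists x, 0; rewrite mul0r addr0.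
- by exists (r * s) => //; exists 0, 1; rewrite mul1r add0r; split=> //; case: hI.
(* The relations [k b] have leading coefficient [s] modulo (I : r) only; r times them has leading
   coefficient r s modulo [I], as [extends_mod_step] requires. *)
exists (t (r * s) :: rs).
apply: (@extends_mod_step _ _ _ basisR K (ext I) (t (r * s)) rs hK hpure hJ _
  (@fidx_lt n m) (fun b => ~ M b) (fun b => tm (r *: k b))).
- apply: extends_mod_sub hrs => x hx; apply: hx.
    exact: ideal_add_principal.
  move=> _ [_ [j [y [hj ->]]] ->]; exists (t j), (t y); split.
    by apply: mem_ideal_gen; exists j.
  by rewrite rmorphD rmorphM.
- exact: fidx_lt_wf.
- move=> b /contrapT Mb; have [Nk ks kl] := hk b Mb; split.
  + by apply: tmN; exact: submoduleZ.
  + rewrite coord_map coordZ ks subrr; by case: hJ.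
  + move=> c ncb h; apply: kl => // hc; apply: h; rewrite coord_map coordZ.
    by apply: mem_ideal_gen; exists (r * coord basisA (k b) c).
move=> H hH HJ Hk Hr; apply: K_tmN => //.
have tm0 : tm 0 = 0 by apply/ffunP => i; rewrite !ffunE raddf0.
have tmZ a v : tm (a *: v) = t a *: tm v.
  by rewrite -[a *: v]addr0 fmod_mapP tm0 addr0.
apply: (@leading_reduction A n m N (fun v => H (tm v)) I r s k) => //.
- split=> [|a x y hx hy]; first by rewrite tm0; case: hH.
  by rewrite fmod_mapP; exact: hH.2.
- move=> v Nv hv; apply: HJ; first exact: tmN.
  by move=> b; rewrite coord_map; apply: mem_ideal_gen; exists (coord basisA v b).
- by move=> b Mb; apply: Hk => h; exact: h.
- by move=> v Nv; rewrite tmZ => h; apply: Hr => //; exact: tmN.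
Qed.

Lemma extends_descent : exists rs, extends_mod K rs (fun x => x = 0).
Proof.
have [|rs hrs] := @extends_noetherian (fun x => x = 0).
  by split=> // a x y -> ->; rewrite scaler0 addr0.
exists rs; apply: extends_mod_sub hrs => x hx; apply: (hx (fun x => x = 0)).
  by split=> // a y z -> ->; rewrite scaler0 addr0.
by move=> _ [y -> ->]; rewrite rmorph0.
Qed.
End Descent.

Theorem theorem1p4 (R : comNzRingType) (S : comPzRingType)
    (phi : {rmorphism R -> S}) (F : lmodType S) :
  fin_pres_algebra phi ->
  fin_pres_module F ->
  flat (resmod phi F) ->
  finitely_very_flat (resmod phi F).
Proof.
move=> hS hF hflat.
have [n [m [J [gen [pr [pr_surj KM Kgen K_span]]]]]] := module_presentation hS hF.
pose cs := flatten [seq [seq (gen ji.1 ji.2)@_a | a <- msupp (gen ji.1 ji.2)]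
  | ji <- enum {: J * 'I_n}].
have [A [t [hA ht]]] := noetherian_cover cs.
have [j|gen0 hgen0] := @choice _ _ (fun j w => fmod_map t w = gen j).
  apply: fmod_map_lift => i a ha; apply: ht; apply/flatten_mapP.
  by exists (j, i); [rewrite mem_enum | apply/mapP; exists a].
have [|||||rs hrs] := @extends_descent A R t n m J gen0 (fun v => pr v = 0) hA.
- exact: submodule_ker.
- exact: flat_pure.
- exact: KM.
- by move=> j; rewrite hgen0.
- by move=> v /K_span [u ->]; exists u; apply: eq_bigr => j _; rewrite hgen0.
exists rs => C hC; apply: (extends_Ext1 (fmod_basis R n m) pr_surj).
apply: hrs; first exact: contraadjusted_telescopes.
by move=> a -> c; rewrite scale0r.
Qed.
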